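(* Let $H$ be a Hilbert $\mathfrak{A}$-module over a $C^*$-algebra $\mathfrak{A}$, and let $(\pi,X)$ be a faithful unital representation of $\mathcal{L}(H)$. Then for all weights $M,N\in\mathcal{L}(H)$ and every operator $A\in\mathcal{L}(H)$, $A^\dag_{MN}$ exists if and only if $\pi(A)^\dag_{\pi(M)\pi(N)}$ exists. In such case, $\pi(A)^\dag_{\pi(M)\pi(N)}=\pi(A^\dag_{MN})$.
   Context: $\mathcal{L}(H)$ is the $C^*$-algebra of adjointable operators on $H$. A representation $(\pi,X)$ of a $C^*$-algebra $\mathfrak{B}$ consists of a Hilbert space $X$ and a $*$-homomorphism $\pi:\mathfrak{B}\to\mathbb{B}(X)$, where $\mathbb{B}(X)$ is the algebra of bounded linear operators on $X$; faithful means $\pi$ is injective, unital means $\pi$ maps the unit to the identity. A weight on a Hilbert module (or Hilbert space) $H$ is a self-adjoint operator in $\mathcal{L}(H)$ that is invertible in $\mathcal{L}(H)$ (for a Hilbert space $X$, $\mathcal{L}(X)=\mathbb{B}(X)$). For weights $M,N$ and an operator $A$ in $\mathcal{L}(H)$, the weighted Moore-Penrose inverse $A^\dag_{MN}$ (if it exists) is the (necessarily unique) element $Z\in\mathcal{L}(H)$ satisfying $AZA=A$, $ZAZ=Z$, $(MAZ)^*=MAZ$, $(NZA)^*=NZA$. *)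

(* Defs.v *)
From HB Require Import structures.
From mathcomp Require Import all_boot all_order all_algebra complex.
From mathcomp Require Import all_classical all_reals all_analysis.
From mathcomp Require Import ring.

Set Implicit Arguments.
Unset Strict Implicit.
Unset Printing Implicit Defensive.

Import Order.TTheory GRing.Theory Num.Theory.
Import numFieldNormedType.Exports.

Local Open Scope classical_set_scope.
Local Open Scope ring_scope.
Local Open Scope complex_scope.

(* The complex field is R[i], for a realType R. *)

Reserved Notation "a *o b" (at level 40, left associativity).

(* Complex *-algebras, not assumed to be unital. The product is not that of  *)
(* the library's rings, which are unital (and non-zero, for algType).        *)
HB.mixin Record isStarAlgebra (R : realType) A of GRing.Lmodule R[i] A := {
  smul : A -> A -> A;
  star : A -> A;
  smulA : associative smul;
  smulDl : left_distributive smul +%R;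
  smulDr : right_distributive smul +%R;
  smulZl : forall (k : R[i]) (a b : A), smul (k *: a) b = k *: smul a b;
  smulZr : forall (k : R[i]) (a b : A), smul a (k *: b) = k *: smul a b;
  starK : involutive star;
  starD : {morph star : a b / a + b};
  starZ : forall (k : R[i]) (a : A), star (k *: a) = Num.conj k *: star a;
  starM : forall a b : A, star (smul a b) = smul (star b) (star a)
}.

#[short(type="starAlgType")]
HB.structure Definition StarAlgebra (R : realType) :=
  {A of isStarAlgebra R A & GRing.Lmodule R[i] A}.

Notation "a *o b" := (smul a b) : ring_scope.

HB.mixin Record isUnitalStarAlgebra (R : realType) A of StarAlgebra R A := {
  sone : A;
  smul1l : forall a : A, sone *o a = a;
  smul1r : forall a : A, a *o sone = a
}.

#[short(type="unitalStarAlgType")]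
HB.structure Definition UnitalStarAlgebra (R : realType) :=
  {A of isUnitalStarAlgebra R A & StarAlgebra R A}.

HB.mixin Record isCstarAlgebra (R : realType) A
    of CompleteNormedModule R[i] A & StarAlgebra R A := {
  norm_smul_le : forall a b : A, `|a *o b| <= `|a| * `|b|;
  norm_star_smul : forall a : A, `|star a *o a| = `|a| ^+ 2
}.

#[short(type="cstarAlgType")]
HB.structure Definition CstarAlgebra (R : realType) :=
  {A of isCstarAlgebra R A & CompleteNormedModule R[i] A & StarAlgebra R A}.

Definition cstar_nonneg (R : realType) (A : cstarAlgType R) (a : A) : Prop :=
  exists b : A, a = star b *o b.

(* Right Hilbert A-modules, the A-valued inner product being linear in its   *)
(* second argument. The norm of the carrier is |x| = |<x, x>|^(1/2), by      *)
(* ahip_norm, and completeness is with respect to it.                        *)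
HB.mixin Record isHilbertModule (R : realType) (A : cstarAlgType R) H
    of CompleteNormedModule R[i] H := {
  ract : H -> A -> H;
  ractDl : forall (x y : H) (a : A), ract (x + y) a = ract x a + ract y a;
  ractDr : forall (x : H) (a b : A), ract x (a + b) = ract x a + ract x b;
  ractM : forall (x : H) (a b : A), ract x (a *o b) = ract (ract x a) b;
  ractZl : forall (k : R[i]) (x : H) (a : A), ract (k *: x) a = k *: ract x a;
  ractZr : forall (k : R[i]) (x : H) (a : A), ract x (k *: a) = k *: ract x a;
  ahip : H -> H -> A;
  ahipDr : forall x y z : H, ahip x (y + z) = ahip x y + ahip x z;
  ahipZr : forall (k : R[i]) (x y : H), ahip x (k *: y) = k *: ahip x y;
  ahip_ract : forall (x y : H) (a : A), ahip x (ract y a) = ahip x y *o a;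
  ahip_star : forall x y : H, ahip y x = star (ahip x y);
  ahip_ge0 : forall x : H, cstar_nonneg (ahip x x);
  ahip_eq0 : forall x : H, ahip x x = 0 -> x = 0;
  ahip_norm : forall x : H, `|x| ^+ 2 = `|ahip x x|
}.

#[short(type="hilbertModType")]
HB.structure Definition HilbertModule (R : realType) (A : cstarAlgType R) :=
  {H of isHilbertModule R A H & CompleteNormedModule R[i] H}.

(* Complex Hilbert spaces; positivity and definiteness of the inner product  *)
(* follow from hip_norm.                                                     *)
HB.mixin Record isHilbertSpace (R : realType) X
    of CompleteNormedModule R[i] X := {
  hip : X -> X -> R[i];
  hipDr : forall x y z : X, hip x (y + z) = hip x y + hip x z;
  hipZr : forall (k : R[i]) (x y : X), hip x (k *: y) = k * hip x y;
  hip_conj : forall x y : X, hip y x = Num.conj (hip x y);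
  hip_norm : forall x : X, `|x| ^+ 2 = hip x x
}.

#[short(type="hilbertType")]
HB.structure Definition HilbertSpace (R : realType) :=
  {X of isHilbertSpace R X & CompleteNormedModule R[i] X}.

(* An adjointable operator comes with its adjoint; as the adjoint is unique, *)
(* this is the same as the existence of one (see adjointable_ext). Linearity *)
(* over C and A, and boundedness, are consequences.                          *)
Record adjointable (R : realType) (A : cstarAlgType R) (H : hilbertModType A) :=
  Adjointable {
    adj_fun :> H -> H;
    adj_adj : H -> H;
    adj_funP : forall x y : H, ahip (adj_fun x) y = ahip x (adj_adj y)
  }.

Lemma star0 (R : realType) (V : starAlgType R) : star (0 : V) = 0.
Proof. by rewrite -[X in star X](scale0r (0 : V)) starZ conjC0 scale0r. Qed.

Lemma starN (R : realType) (V : starAlgType R) (a : V) : star (- a) = - star a.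
Proof. by apply/eqP; rewrite -addr_eq0 -starD addNr star0 eqxx. Qed.

Section AdjointableAlgebra.
Variables (R : realType) (A : cstarAlgType R) (H : hilbertModType A).
Implicit Types (x y z : H) (S T : adjointable H) (k : R[i]).

Lemma ahipDl x y z : ahip (x + y) z = ahip x z + ahip y z.
Proof. by rewrite ahip_star ahipDr starD -!ahip_star. Qed.

Lemma ahipZl k x y : ahip (k *: x) y = Num.conj k *: ahip x y.
Proof. by rewrite ahip_star ahipZr starZ -ahip_star. Qed.

Lemma ahipNr x y : ahip x (- y) = - ahip x y.
Proof. by rewrite -scaleN1r ahipZr scaleN1r. Qed.

Lemma ahipNl x y : ahip (- x) y = - ahip x y.
Proof. by rewrite ahip_star ahipNr starN -ahip_star. Qed.

Lemma ahip0r x : ahip x 0 = 0.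
Proof. by rewrite -[X in ahip x X](scale0r (0 : H)) ahipZr scale0r. Qed.

Lemma ahip0l x : ahip 0 x = 0.
Proof. by rewrite ahip_star ahip0r star0. Qed.

Lemma ahip_inj x y : (forall z, ahip z x = ahip z y) -> x = y.
Proof.
move=> xy; apply/eqP; rewrite -subr_eq0; apply/eqP/ahip_eq0.
by rewrite ahipDr ahipNr xy subrr.
Qed.

Lemma adjointable_ext S T : S =1 T -> S = T.
Proof.
case: S T => [f f' fP] [g g' gP] /= /funext fg.
have fg' : f' = g'.
  by apply: funext => y; apply: ahip_inj => x; rewrite -fP fg gP.
by subst g g'; rewrite (Prop_irrelevance fP gP).
Qed.

HB.instance Definition _ := gen_eqMixin (adjointable H).
HB.instance Definition _ := gen_choiceMixin (adjointable H).

Definition adj_zero : adjointable H.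
Proof. by exists (fun=> 0) (fun=> 0) => x y; rewrite ahip0l ahip0r. Defined.

Definition adj_opp T : adjointable H.
Proof.
by exists (fun x => - T x) (fun x => - adj_adj T x) => x y;
   rewrite ahipNl ahipNr adj_funP.
Defined.

Definition adj_add S T : adjointable H.
Proof.
by exists (fun x => S x + T x) (fun x => adj_adj S x + adj_adj T x) => x y;
   rewrite ahipDl ahipDr !adj_funP.
Defined.

Definition adj_scale k T : adjointable H.
Proof.
by exists (fun x => k *: T x) (fun x => Num.conj k *: adj_adj T x) => x y;
   rewrite ahipZl ahipZr adj_funP.
Defined.

Definition adj_one : adjointable H.
Proof. by exists id id. Defined.

Definition adj_mul S T : adjointable H.
Proof.
by exists (S \o T) (adj_adj T \o adj_adj S) => x y /=; rewrite !adj_funP.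
Defined.

Definition adj_star T : adjointable H.
Proof.
by exists (adj_adj T) T => x y; rewrite ahip_star -adj_funP -ahip_star.
Defined.

Lemma adj_addA : associative adj_add.
Proof. by move=> S T U; apply: adjointable_ext => x /=; rewrite addrA. Qed.
Lemma adj_addC : commutative adj_add.
Proof. by move=> S T; apply: adjointable_ext => x /=; rewrite addrC. Qed.
Lemma adj_add0 : left_id adj_zero adj_add.
Proof. by move=> S; apply: adjointable_ext => x /=; rewrite add0r. Qed.
Lemma adj_addN : left_inverse adj_zero adj_opp adj_add.
Proof. by move=> S; apply: adjointable_ext => x /=; rewrite addNr. Qed.

HB.instance Definition _ :=
  GRing.isZmodule.Build (adjointable H) adj_addA adj_addC adj_add0 adj_addN.

Lemma adj_funD T x y : T (x + y) = T x + T y.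
Proof.
by apply: ahip_inj => z; rewrite ahipDr !(ahip_star _ z) !adj_funP ahipDl starD.
Qed.

Lemma adj_funZ T k x : T (k *: x) = k *: T x.
Proof.
apply: ahip_inj => z.
by rewrite ahipZr !(ahip_star _ z) !adj_funP ahipZl starZ conjCK.
Qed.

Lemma adj_scaleA k l T : adj_scale k (adj_scale l T) = adj_scale (k * l) T.
Proof. by apply: adjointable_ext => x /=; rewrite scalerA. Qed.
Lemma adj_scale1 : left_id 1 adj_scale.
Proof. by move=> T; apply: adjointable_ext => x /=; rewrite scale1r. Qed.
Lemma adj_scaleDr : right_distributive adj_scale +%R.
Proof. by move=> k S T; apply: adjointable_ext => x /=; rewrite scalerDr. Qed.
Lemma adj_scaleDl T : {morph adj_scale^~ T : k l / k + l}.
Proof. by move=> k l; apply: adjointable_ext => x /=; rewrite scalerDl. Qed.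

HB.instance Definition _ := GRing.Zmodule_isLmodule.Build R[i] (adjointable H)
  adj_scaleA adj_scale1 adj_scaleDr adj_scaleDl.

Lemma adj_mulA : associative adj_mul.
Proof. by move=> S T U; apply: adjointable_ext. Qed.
Lemma adj_mulDl : left_distributive adj_mul +%R.
Proof. by move=> S T U; apply: adjointable_ext. Qed.
Lemma adj_mulDr : right_distributive adj_mul +%R.
Proof. by move=> S T U; apply: adjointable_ext => x /=; rewrite adj_funD. Qed.
Lemma adj_mulZl k S T : adj_mul (k *: S) T = k *: adj_mul S T.
Proof. by apply: adjointable_ext. Qed.
Lemma adj_mulZr k S T : adj_mul S (k *: T) = k *: adj_mul S T.
Proof. by apply: adjointable_ext => x /=; rewrite adj_funZ. Qed.
Lemma adj_starK : involutive adj_star.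
Proof. by move=> T; apply: adjointable_ext. Qed.
Lemma adj_starD : {morph adj_star : S T / S + T}.
Proof. by move=> S T; apply: adjointable_ext. Qed.
Lemma adj_starZ k T : adj_star (k *: T) = Num.conj k *: adj_star T.
Proof. by apply: adjointable_ext. Qed.
Lemma adj_starM S T : adj_star (adj_mul S T) = adj_mul (adj_star T) (adj_star S).
Proof. by apply: adjointable_ext. Qed.

HB.instance Definition _ := isStarAlgebra.Build R (adjointable H)
  adj_mulA adj_mulDl adj_mulDr adj_mulZl adj_mulZr
  adj_starK adj_starD adj_starZ adj_starM.

Lemma adj_mul1l T : adj_one *o T = T.
Proof. by apply: adjointable_ext. Qed.
Lemma adj_mul1r T : T *o adj_one = T.
Proof. by apply: adjointable_ext. Qed.

HB.instance Definition _ :=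
  isUnitalStarAlgebra.Build R (adjointable H) adj_mul1l adj_mul1r.

End AdjointableAlgebra.
Section HilbertSpaceTheory.
Variables (R : realType) (X : hilbertType R).
Implicit Types (x y z h : X) (k : R[i]).

Lemma hipDl x y z : hip (x + y) z = hip x z + hip y z.
Proof. by rewrite hip_conj hipDr rmorphD /= -!hip_conj. Qed.

Lemma hipZl k x y : hip (k *: x) y = Num.conj k * hip x y.
Proof. by rewrite hip_conj hipZr rmorphM /= -hip_conj. Qed.

Lemma hipNr x y : hip x (- y) = - hip x y.
Proof. by rewrite -scaleN1r hipZr mulN1r. Qed.

Lemma hipNl x y : hip (- x) y = - hip x y.
Proof. by rewrite hip_conj hipNr rmorphN /= -hip_conj. Qed.

Lemma hip0r x : hip x 0 = 0.
Proof. by rewrite -[X in hip x X](scale0r (0 : X)) hipZr mul0r. Qed.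

Lemma hip_inj x y : (forall z, hip z x = hip z y) -> x = y.
Proof.
move=> xy; apply/eqP; rewrite -subr_eq0 -normr_eq0 -sqrf_eq0 hip_norm.
by rewrite hipDr hipNr xy subrr.
Qed.

Lemma norm_sqrDZ x h k :
  `|x + k *: h| ^+ 2 =
  `|x| ^+ 2 + (k * hip x h + Num.conj (k * hip x h)) + `|k| ^+ 2 * `|h| ^+ 2.
Proof.
rewrite !hip_norm hipDl !hipDr !hipZl !hipZr (hip_conj x h) rmorphM normCK.
by rewrite !addrA mulrCA !mulrA.
Qed.

Lemma hip_normS x y : `|hip x y| ^+ 2 <= `|x| ^+ 2 * `|y| ^+ 2.
Proof.
have [->|y0] := eqVneq y 0; first by rewrite hip0r !normr0 !expr0n /= mulr0.
have ny0 : 0 < `|y| ^+ 2 by rewrite exprn_gt0// normr_gt0.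
set g := hip x y; pose k := - Num.conj g / `|y| ^+ 2.
have := exprn_ge0 2 (normr_ge0 (x + k *: y)).
have kg : k * g = - (`|g| ^+ 2 / `|y| ^+ 2).
  by rewrite normCKC /k mulrAC !mulNr.
have nk : `|k| ^+ 2 * `|y| ^+ 2 = `|g| ^+ 2 / `|y| ^+ 2.
  rewrite /k normrM normrN norm_conjC normfV (ger0_norm (ltW ny0)).
  by rewrite exprMn exprVn; field; rewrite normr_eq0.
rewrite norm_sqrDZ -/g kg nk rmorphN /= (CrealP _); last first.
  by rewrite rpredM ?realV ?realX ?normr_real.
by rewrite addrA addrNK subr_ge0 ler_pdivrMr.
Qed.

Lemma hip_norm_le x y : `|hip x y| <= `|x| * `|y|.
Proof.
rewrite -(@ler_pXn2r _ 2) ?nnegrE ?mulr_ge0//.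
by rewrite exprMn hip_normS.
Qed.

Section Riesz.
Variable f : X -> R[i].
Hypothesis fD : forall x y, f (x + y) = f x + f y.
Hypothesis fZ : forall k x, f (k *: x) = k * f x.
Variable K : R[i].
Hypothesis fK : forall x, `|f x| <= K * `|x|.

Let Q x : R[i] := `|x| ^+ 2 - (f x + Num.conj (f x)).

Let Q_real x : Q x \is Num.real.
Proof.
rewrite rpredB ?realX ?normr_real//; apply/CrealP.
by rewrite rmorphD /= conjCK addrC.
Qed.

Let QDZ x h k : Q (x + k *: h) = Q x +
  (k * (hip x h - f h) + Num.conj (k * (hip x h - f h))) + `|k| ^+ 2 * `|h| ^+ 2.
Proof.
by rewrite /Q norm_sqrDZ fD fZ mulrBr !(rmorphD, rmorphB, rmorphN) /=; ring.
Qed.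

Let Q_lower x : - `|K| ^+ 2 <= Q x.
Proof.
have fK' : `|f x| <= `|K| * `|x|.
  have Kx : 0 <= K * `|x| := le_trans (normr_ge0 _) (fK x).
  by rewrite (le_trans (fK x))// -[`|x| in leRHS]normr_id -normrM ger0_norm.
have fR : f x + Num.conj (f x) <= `|f x| + `|f x|.
  have r : f x + Num.conj (f x) \is Num.real.
    by apply/CrealP; rewrite rmorphD /= conjCK addrC.
  rewrite (le_trans (real_ler_norm r))// (le_trans (ler_normD _ _))//.
  by rewrite norm_conjC.
have sq : 0 <= (`|x| - `|K|) ^+ 2.
  by rewrite real_exprn_even_ge0// rpredB// normr_real.
rewrite -subr_ge0.
have -> : Q x - - `|K| ^+ 2 = (`|x| - `|K|) ^+ 2
    + (`|f x| + `|f x| - (f x + Num.conj (f x))) + 2 * (`|K| * `|x| - `|f x|).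
  by rewrite /Q; ring.
apply: addr_ge0; first by rewrite addr_ge0// subr_ge0.
by apply: mulr_ge0; rewrite ?ler0n// subr_ge0.
Qed.

Let Q_inf : exists d : R[i], (forall x, d <= Q x) /\
  (forall e : R[i], 0 < e -> exists x, Q x < d + e).
Proof.
pose q x : R := complex.Re (Q x).
have qQ x : (q x)%:C = Q x by rewrite /q RRe_real.
have hq : has_inf (range q).
  split; first by exists (q 0); exists 0.
  exists (complex.Re (- `|K| ^+ 2)) => _ [x _ <-].
  by rewrite -lecR qQ RRe_real ?Q_lower// rpredN realX// normr_real.
exists (inf (range q))%:C; split=> [x|e e0].
  by rewrite -qQ lecR; apply: ge_inf => //; case: hq.
have er : (complex.Re e)%:C = e by rewrite RRe_real// gtr0_real.
have e0' : 0 < complex.Re e by rewrite -ltcR er.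
have [_ [x _ <-] hx] := inf_adherent e0' hq.
by exists x; rewrite -qQ -er -rmorphD ltcR.
Qed.

Lemma riesz : exists y, forall h, hip y h = f h.
Proof.
have [d [dQ dQe]] := Q_inf.
have near_min (e : R[i]) x h : Q x < d + e ->
    `|hip x h - f h| ^+ 2 <= e * `|h| ^+ 2.
  move=> xe; set g := hip x h - f h.
  have [h0|h0] := eqVneq h 0.
    have f0 : f 0 = 0 by rewrite -(scale0r (0 : X)) fZ mul0r.
    by rewrite /g h0 hip0r f0 subrr !normr0 !expr0n /= mulr0.
  have nh0 : 0 < `|h| ^+ 2 by rewrite exprn_gt0// normr_gt0.
  pose k := - Num.conj g / `|h| ^+ 2.
  have kg : k * g = - (`|g| ^+ 2 / `|h| ^+ 2).
    by rewrite normCKC /k mulrAC !mulNr.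
  have nk : `|k| ^+ 2 * `|h| ^+ 2 = `|g| ^+ 2 / `|h| ^+ 2.
    rewrite /k normrM normrN norm_conjC normfV (ger0_norm (ltW nh0)).
    by rewrite exprMn exprVn; field; rewrite normr_eq0.
  have := dQ (x + k *: h).
  rewrite QDZ -/g kg nk rmorphN /= (CrealP _); last first.
    by rewrite rpredM ?realV ?realX ?normr_real.
  rewrite addrA addrNK lerBrDl -lerBrDr => dg.
  rewrite -ler_pdivrMr//; apply: (le_trans dg).
  by rewrite lerBlDl ltW.
have near_pair (e : R[i]) x y : Q x < d + e -> Q y < d + e ->
    `|x - y| ^+ 2 <= 4 * e.
  move=> xe ye.
  have par : `|x - y| ^+ 2 = 2 * Q x + 2 * Q y - 4 * Q (2^-1 *: (x + y)).
    rewrite /Q fZ !fD !hip_norm !(hipDl, hipDr, hipZl, hipZr, hipNl, hipNr).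
    rewrite !(rmorphM, rmorphD, fmorphV) /= conjC1.
    by field.
  rewrite par -subr_ge0.
  have -> : 4 * e - (2 * Q x + 2 * Q y - 4 * Q (2^-1 *: (x + y))) =
    2 * (d + e - Q x) + 2 * (d + e - Q y) + 4 * (Q (2^-1 *: (x + y)) - d) by ring.
  by rewrite !addr_ge0// mulr_ge0// subr_ge0// ltW.
pose S (e : R) := [set x | Q x < d + e%:C].
pose F := filter_from [set e : R | 0 < e] S.
have FF : ProperFilter F.
  apply: filter_from_proper; last first.
    move=> e /= e0; have [|x xe] := dQe e%:C; first by rewrite ltcR.
    by exists x.
  apply: filter_from_filter; first by exists 1; rewrite /= ltr01.
  move=> a b /= a0 b0; exists (Order.min a b); first by rewrite /= lt_min a0.
  move=> x /= xab; split; apply: (lt_le_trans xab); rewrite lerD2l lecR.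
    by rewrite ge_min lexx.
  by rewrite ge_min lexx orbT.
have cF : cauchy F.
  apply/cauchy_ballP => eps eps0.
  have er : (complex.Re eps)%:C = eps by rewrite RRe_real// gtr0_real.
  have e0 : 0 < complex.Re eps by rewrite -ltcR er.
  pose e := (complex.Re eps) ^+ 2 / 8.
  have e0' : 0 < e by rewrite divr_gt0// exprn_gt0.
  exists (S e, S e) => /=; first by split; exists e.
  move=> [x y] /= [xe ye]; rewrite -ball_normE /=.
  rewrite -(@ltr_pXn2r _ 2) ?nnegrE ?(ltW eps0)//.
  apply: (le_lt_trans (near_pair _ _ _ xe ye)).
  have -> : 4 * e%:C = eps ^+ 2 / 2.
    rewrite /e rmorphM fmorphV rmorphXn /= er.
    by field.
  by rewrite ltr_pdivrMr// ltr_pMr ?exprn_gt0// ltr1n.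
have /cvg_ex[/= y Fy] := @cauchy_cvg _ F FF cF.
exists y => h; apply/eqP; rewrite -subr_eq0; apply: contraT => a0.
have h0 : h != 0.
  apply: contra_neq a0 => ->.
  by rewrite hip0r -(scale0r (0 : X)) fZ mul0r subrr.
set a := `|hip y h - f h|.
have {}a0 : 0 < a by rewrite normr_gt0.
have nh0 : 0 < `|h| by rewrite normr_gt0.
pose eps := a / (4 * `|h|).
have eps0 : 0 < eps by rewrite divr_gt0// mulr_gt0.
have er : (complex.Re eps)%:C = eps by rewrite RRe_real// gtr0_real.
have e0 : 0 < complex.Re eps by rewrite -ltcR er.
have Fb : F (ball y eps) by apply: Fy; exact: nbhsx_ballx.
have FS : F (S (complex.Re eps ^+ 2)) by exists (complex.Re eps ^+ 2) => //=; rewrite exprn_gt0.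
have [x [/= yx]] := @filter_ex _ F FF _ (@filterI _ F _ _ _ Fb FS).
rewrite /S /= rmorphXn /= er => xe.
have := near_min _ _ h xe.
rewrite -exprMn ler_pXn2r ?nnegrE ?(mulr_ge0 (ltW eps0))// => g1.
have g2 : `|hip (y - x) h| <= eps * `|h|.
  apply: (le_trans (hip_norm_le _ _)); rewrite ler_wpM2r//.
  by move: yx; rewrite -ball_normE /= => /ltW.
have : a <= eps * `|h| + eps * `|h|.
  apply: le_trans (lerD g2 g1); apply: le_trans (ler_normD _ _).
  by rewrite hipDl hipNl addrA addrNK.
have -> : eps * `|h| + eps * `|h| = a / 2.
  by rewrite /eps; field; rewrite normr_eq0.
by rewrite lt_geF// ltr_pdivrMr// ltr_pMr// ltr1n.
Qed.

End Riesz.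
End HilbertSpaceTheory.

(* Unlike on Hilbert modules, adjoints exist here by the Riesz theorem, see  *)
(* bop_adjoint; bop_star picks the adjoint, characterized by bop_starP.      *)
Record bounded_op (R : realType) (X : hilbertType R) := BoundedOp {
    bop_fun :> X -> X;
    bop_linear : linear bop_fun;
    bop_bounded : exists K : R[i], forall x : X, `|bop_fun x| <= K * `|x|
  }.

Section BoundedAlgebra.
Variables (R : realType) (X : hilbertType R).
Implicit Types (x y z : X) (S T : bounded_op X) (k : R[i]).

Lemma bop_ext S T : S =1 T -> S = T.
Proof.
case: S T => [f fl fb] [g gl gb] /= /funext fg; subst g.
by rewrite (Prop_irrelevance fl gl) (Prop_irrelevance fb gb).
Qed.

Lemma bopD T x y : T (x + y) = T x + T y.
Proof. by have := bop_linear T 1 x y; rewrite !scale1r. Qed.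

Lemma bop0 T : T 0 = 0.
Proof. by apply: (addrI (T 0)); rewrite -bopD !addr0. Qed.

Lemma bopZ T k x : T (k *: x) = k *: T x.
Proof. by have := bop_linear T k x 0; rewrite bop0 !addr0. Qed.

Lemma bop_bound T : exists2 K : R[i], 0 <= K & forall x, `|T x| <= K * `|x|.
Proof.
have [K TK] := bop_bounded T; exists `|K| => // x.
have Kx : 0 <= K * `|x| := le_trans (normr_ge0 _) (TK x).
by rewrite (le_trans (TK x))// -[`|x| in leRHS]normr_id -normrM ger0_norm.
Qed.

Lemma bop_adjoint T : exists S, forall x y, hip (T x) y = hip x (S y).
Proof.
have [K K0 TK] := bop_bound T.
have /choice[g gP] : forall y, exists z, forall h, hip z h = hip y (T h).
  move=> y; apply: (@riesz _ _ _ _ _ (`|y| * K)) => [u v|k u|u].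
  - by rewrite bopD hipDr.
  - by rewrite bopZ hipZr.
  - by rewrite (le_trans (hip_norm_le _ _))// -mulrA ler_wpM2l.
have gT x y : hip (T x) y = hip x (g y).
  by rewrite hip_conj -gP -hip_conj.
have gl : linear g.
  by move=> k u v; apply: hip_inj => z; rewrite -gT !hipDr !hipZr !gT.
have gb : exists K : R[i], forall x, `|g x| <= K * `|x|.
  exists K => x; have [->|gx0] := eqVneq (g x) 0.
    by rewrite normr0 mulr_ge0.
  rewrite -(@ler_pM2l _ `|g x|) ?normr_gt0// -expr2.
  rewrite hip_norm -gT -[leLHS]ger0_norm; last by rewrite gT -hip_norm exprn_ge0.
  apply: (le_trans (hip_norm_le _ _)).
  by rewrite mulrA ler_wpM2r// mulrC TK.
by exists (BoundedOp gl gb).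
Qed.

HB.instance Definition _ := gen_eqMixin (bounded_op X).
HB.instance Definition _ := gen_choiceMixin (bounded_op X).

Definition bop_zero : bounded_op X.
Proof.
exists (fun=> 0) => [k x y|]; first by rewrite scaler0 addr0.
by exists 0 => x; rewrite normr0 mul0r.
Defined.

Definition bop_opp T : bounded_op X.
Proof.
exists (fun x => - T x) => [k x y|].
  by rewrite bop_linear opprD scalerN.
by have [K _ TK] := bop_bound T; exists K => x; rewrite normrN.
Defined.

Definition bop_add S T : bounded_op X.
Proof.
exists (fun x => S x + T x) => [k x y|].
  by rewrite !bop_linear scalerDr addrACA.
have [[K _ SK] [L _ TL]] := (bop_bound S, bop_bound T).
exists (K + L) => x; rewrite mulrDl.
by rewrite (le_trans (ler_normD _ _))// lerD.
Defined.

Definition bop_scale k T : bounded_op X.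
Proof.
exists (fun x => k *: T x) => [l x y|].
  by rewrite bop_linear scalerDr !scalerA mulrC.
have [K _ TK] := bop_bound T; exists (`|k| * K) => x.
by rewrite normrZ -mulrA ler_wpM2l.
Defined.

Definition bop_one : bounded_op X.
Proof. by exists id => //; exists 1 => x; rewrite mul1r. Defined.

Definition bop_mul S T : bounded_op X.
Proof.
exists (S \o T) => [k x y|] /=; first by rewrite !bop_linear.
have [[K K0 SK] [L _ TL]] := (bop_bound S, bop_bound T).
exists (K * L) => x; rewrite (le_trans (SK _))// -mulrA.
by rewrite ler_wpM2l.
Defined.

Definition bop_star T : bounded_op X := projT1 (cid (bop_adjoint T)).

Lemma bop_starP T x y : hip (T x) y = hip x (bop_star T y).
Proof. exact: (projT2 (cid (bop_adjoint T))). Qed.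

Lemma bop_star_unique T S :
  (forall x y, hip (T x) y = hip x (S y)) -> bop_star T = S.
Proof.
by move=> TS; apply: bop_ext => y; apply: hip_inj => x; rewrite -bop_starP TS.
Qed.

Lemma bop_addA : associative bop_add.
Proof. by move=> S T U; apply: bop_ext => x /=; rewrite addrA. Qed.
Lemma bop_addC : commutative bop_add.
Proof. by move=> S T; apply: bop_ext => x /=; rewrite addrC. Qed.
Lemma bop_add0 : left_id bop_zero bop_add.
Proof. by move=> S; apply: bop_ext => x /=; rewrite add0r. Qed.
Lemma bop_addN : left_inverse bop_zero bop_opp bop_add.
Proof. by move=> S; apply: bop_ext => x /=; rewrite addNr. Qed.

HB.instance Definition _ :=
  GRing.isZmodule.Build (bounded_op X) bop_addA bop_addC bop_add0 bop_addN.

Lemma bop_scaleA k l T : bop_scale k (bop_scale l T) = bop_scale (k * l) T.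
Proof. by apply: bop_ext => x /=; rewrite scalerA. Qed.
Lemma bop_scale1 : left_id 1 bop_scale.
Proof. by move=> T; apply: bop_ext => x /=; rewrite scale1r. Qed.
Lemma bop_scaleDr : right_distributive bop_scale +%R.
Proof. by move=> k S T; apply: bop_ext => x /=; rewrite scalerDr. Qed.
Lemma bop_scaleDl T : {morph bop_scale^~ T : k l / k + l}.
Proof. by move=> k l; apply: bop_ext => x /=; rewrite scalerDl. Qed.

HB.instance Definition _ := GRing.Zmodule_isLmodule.Build R[i] (bounded_op X)
  bop_scaleA bop_scale1 bop_scaleDr bop_scaleDl.

Lemma bop_mulA : associative bop_mul.
Proof. by move=> S T U; apply: bop_ext. Qed.
Lemma bop_mulDl : left_distributive bop_mul +%R.
Proof. by move=> S T U; apply: bop_ext. Qed.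
Lemma bop_mulDr : right_distributive bop_mul +%R.
Proof. by move=> S T U; apply: bop_ext => x /=; rewrite bopD. Qed.
Lemma bop_mulZl k S T : bop_mul (k *: S) T = k *: bop_mul S T.
Proof. by apply: bop_ext. Qed.
Lemma bop_mulZr k S T : bop_mul S (k *: T) = k *: bop_mul S T.
Proof. by apply: bop_ext => x /=; rewrite bopZ. Qed.
Lemma bop_starK : involutive bop_star.
Proof.
move=> T; apply: bop_star_unique => x y.
by rewrite hip_conj -bop_starP -hip_conj.
Qed.
Lemma bop_starD : {morph bop_star : S T / S + T}.
Proof.
move=> S T; apply: bop_star_unique => x y /=.
by rewrite hipDl hipDr !bop_starP.
Qed.
Lemma bop_starZ k T : bop_star (k *: T) = Num.conj k *: bop_star T.
Proof.
apply: bop_star_unique => x y /=.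
by rewrite hipZl hipZr bop_starP.
Qed.
Lemma bop_starM S T : bop_star (bop_mul S T) = bop_mul (bop_star T) (bop_star S).
Proof. by apply: bop_star_unique => x y /=; rewrite !bop_starP. Qed.

HB.instance Definition _ := isStarAlgebra.Build R (bounded_op X)
  bop_mulA bop_mulDl bop_mulDr bop_mulZl bop_mulZr
  bop_starK bop_starD bop_starZ bop_starM.

Lemma bop_mul1l T : bop_one *o T = T.
Proof. by apply: bop_ext. Qed.
Lemma bop_mul1r T : T *o bop_one = T.
Proof. by apply: bop_ext. Qed.

HB.instance Definition _ :=
  isUnitalStarAlgebra.Build R (bounded_op X) bop_mul1l bop_mul1r.

End BoundedAlgebra.

Record star_morphism (R : realType) (B C : starAlgType R) (pi : B -> C) : Prop :=
  StarMorphism {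
    star_morph_linear : linear pi;
    star_morphM : {morph pi : a b / a *o b};
    star_morph_star : {morph pi : a / star a}
  }.

Definition representation (R : realType) (B : starAlgType R)
    (X : hilbertType R) (pi : B -> bounded_op X) : Prop :=
  star_morphism pi.

Definition faithful (R : realType) (B : starAlgType R)
    (X : hilbertType R) (pi : B -> bounded_op X) : Prop :=
  injective pi.

Definition unital (R : realType) (B : unitalStarAlgType R)
    (X : hilbertType R) (pi : B -> bounded_op X) : Prop :=
  pi sone = sone.

Section WeightedMoorePenrose.
Variables (R : realType) (L : unitalStarAlgType R).
Implicit Types A M N Z : L.

Definition self_adjoint A : Prop := star A = A.

Definition invertible A : Prop := exists Z, A *o Z = sone /\ Z *o A = sone.

Definition weight M : Prop := self_adjoint M /\ invertible M.

(* Z is the weighted Moore-Penrose inverse of A for the weights M and N; it  *)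
(* is unique by wmp_inverse_unique.                                          *)
Definition is_wmp_inverse M N A Z : Prop :=
  [/\ A *o Z *o A = A,
      Z *o A *o Z = Z,
      self_adjoint (M *o A *o Z) &
      self_adjoint (N *o Z *o A)].

Lemma wmp_inverse_unique M N A Z Z' : weight M -> weight N ->
  is_wmp_inverse M N A Z -> is_wmp_inverse M N A Z' -> Z = Z'.
Proof.
move=> [Ms [Mi [MMi MiM]]] [Ns [Ni [NNi NiN]]].
rewrite /is_wmp_inverse /self_adjoint => -[z1 z2 z3 z4] [w1 w2 w3 w4].
have cancelM B C : M *o B = M *o C -> B = C.
  by move=> /(congr1 (smul Mi)); rewrite !smulA MiM !smul1l.
have cancelN B C : N *o B = N *o C -> B = C.
  by move=> /(congr1 (smul Ni)); rewrite !smulA NiN !smul1l.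
have eqM (P B C : L) : star P = P ->
    star (P *o B) = P *o B -> star (P *o C) = P *o C ->
    B *o C = C -> C *o B = B -> P *o C = P *o B.
  move=> Ps PB PC BC CB.
  rewrite -{1}PC -{1}BC smulA starM PB -{1}Ps smulA -starM PC.
  by rewrite -smulA CB.
have eqN (P B C : L) : star P = P ->
    star (P *o B) = P *o B -> star (P *o C) = P *o C ->
    B *o C = B -> C *o B = C -> P *o C = P *o B.
  move=> Ps PB PC BC CB.
  rewrite -{1}PC -{1}CB smulA starM PC -{1}Ps smulA -starM PB.
  by rewrite -smulA BC.
have AZ : A *o Z = A *o Z'.
  by apply: cancelM; apply: eqM; rewrite ?smulA ?z3 ?w3 ?z1 ?w1.
have ZA : Z *o A = Z' *o A.
  apply: cancelN; apply: eqN => //; rewrite ?[N *o _]smulA //.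
    by rewrite -smulA [A *o (Z *o A)]smulA z1.
  by rewrite -smulA [A *o (Z' *o A)]smulA w1.
by rewrite -[LHS]z2 ZA -smulA AZ smulA w2.
Qed.

End WeightedMoorePenrose.

(* Main.v *)
Require Import Defs.
From HB Require Import structures.
From mathcomp Require Import all_boot all_order all_algebra complex.
From mathcomp Require Import all_classical all_reals all_analysis.
From mathcomp Require Import ring lra.

Set Implicit Arguments.
Unset Strict Implicit.
Unset Printing Implicit Defensive.

Import Order.TTheory GRing.Theory Num.Theory.
Import numFieldNormedType.Exports.

Local Open Scope classical_set_scope.
Local Open Scope ring_scope.
Local Open Scope complex_scope.

(* An operator whose image under pi has a generalized inverse has one in      *)
(* L(H): the Landweber iteration converges to it, since norm estimates in     *)
(* B(X) transfer to L(H). The norm transfer rests on square roots, by         *)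
(* iteration, rather than on spectral theory. In particular invertibility in  *)
(* B(X) is reflected, and the weighted Moore-Penrose inverse of pi T is a     *)
(* word in images of T, its weighted adjoint, and the inverse of an operator  *)
(* built from these and a generalized inverse of T.                           *)

(** Being a weighted inverse is a list of *-algebraic equations, which a faithful [pi] preserves and
    reflects. Hence an inverse [Z] in [L(H)] gives the inverse [pi Z] in [B(X)], and uniqueness
    ([wmp_inverse_unique]) settles the formula. The converse amounts to showing that an inverse [W]
    of [pi T] lies in the range of [pi].

    Algebra does this once an inner inverse [K] of [T] is found in [L(H)]: with the weighted adjoint
    [P = N^-1 T^* M], the image of [P T + (1 - K T)] is invertible and [W] is a word in its inverse
    and the images of [P] and [T] ([weighted_adjoint], [regular_wmp_algebra]). The analysis supplies
    [K] ([faithful_regular]) and brings the inverse down to [L(H)] ([faithful_invertible]).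

    [K] is a limit of polynomials in [T] and [T^*]. Their rate of convergence is computed in [B(X)],
    where the inner product is scalar, and brought back by [faithful_bounded]; the limit exists in
    [L(H)] by [adj_seq_cvg]. *)

(** * Linear identities in modules *)

(* A module embeds in its square-zero extension, a commutative ring, where    *)
(* the ring tactic decides linear identities.                                 *)
Definition sqzero (K : comNzRingType) (V : lmodType K) : Type := (K * V)%type.

Section SquareZeroExtension.
Variables (K : comNzRingType) (V : lmodType K).
Local Notation E := (sqzero V).

HB.instance Definition _ := GRing.Zmodule.copy E (K * V)%type.

Definition sqzero_mul (p q : E) : E := (p.1 * q.1, p.1 *: q.2 + q.1 *: p.2).
Definition sqzero_one : E := (1, 0).

Lemma sqzero_mulA : associative sqzero_mul.
Proof.
move=> p q r; congr pair; first exact: mulrA.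
rewrite /= !scalerDr !scalerA -!addrA.
by rewrite [r.1 * p.1]mulrC [r.1 * q.1]mulrC.
Qed.

Lemma sqzero_mulC : commutative sqzero_mul.
Proof. by move=> p q; congr pair; rewrite /= (mulrC, addrC). Qed.

Lemma sqzero_mul1 : left_id sqzero_one sqzero_mul.
Proof.
by move=> [k x]; congr pair; rewrite /= ?mul1r// scale1r scaler0 addr0.
Qed.

Lemma sqzero_mulDl : left_distributive sqzero_mul +%R.
Proof.
move=> p q r; congr pair => /=; first exact: mulrDl.
by rewrite scalerDl scalerDr addrACA.
Qed.

Lemma sqzero_one_neq0 : sqzero_one != 0.
Proof. by apply/eqP => -[/eqP]; rewrite oner_eq0. Qed.

HB.instance Definition _ := GRing.Zmodule_isComNzRing.Build E
  sqzero_mulA sqzero_mulC sqzero_mul1 sqzero_mulDl sqzero_one_neq0.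

Definition sqzero_vec (x : V) : E := (0, x).
Definition sqzero_scal (k : K) : E := (k, 0).

Lemma sqzero_vec_inj : injective sqzero_vec. Proof. by move=> x y []. Qed.

Lemma sqzero_vecD x y : sqzero_vec (x + y) = sqzero_vec x + sqzero_vec y.
Proof. by congr pair; rewrite addr0. Qed.

Lemma sqzero_vecN x : sqzero_vec (- x) = - sqzero_vec x.
Proof. by congr pair; rewrite oppr0. Qed.

Lemma sqzero_vec0 : sqzero_vec 0 = 0. Proof. by []. Qed.

Lemma sqzero_vecMn x n : sqzero_vec (x *+ n) = sqzero_vec x *+ n.
Proof. by elim: n => // n IH; rewrite !mulrS sqzero_vecD IH. Qed.

Lemma sqzero_vecZ k x : sqzero_vec (k *: x) = sqzero_scal k * sqzero_vec x.
Proof. by congr pair; rewrite /= ?mulr0// scale0r addr0. Qed.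

Lemma sqzero_scalD k l : sqzero_scal (k + l) = sqzero_scal k + sqzero_scal l.
Proof. by congr pair; rewrite addr0. Qed.

Lemma sqzero_scalN k : sqzero_scal (- k) = - sqzero_scal k.
Proof. by congr pair; rewrite oppr0. Qed.

Lemma sqzero_scal1 : sqzero_scal 1 = 1. Proof. by []. Qed.

Lemma sqzero_scalM k l : sqzero_scal (k * l) = sqzero_scal k * sqzero_scal l.
Proof. by congr pair; rewrite /= !scaler0 addr0. Qed.

Lemma sqzero_scalMn k n : sqzero_scal (k *+ n) = sqzero_scal k *+ n.
Proof. by elim: n => // n IH; rewrite !mulrS sqzero_scalD IH. Qed.

Definition sqzeroE := (sqzero_vecD, sqzero_vecN, sqzero_vec0, sqzero_vecMn,
  sqzero_vecZ, sqzero_scalD, sqzero_scalN, sqzero_scal1, sqzero_scalM,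
  sqzero_scalMn).

End SquareZeroExtension.

Ltac module := apply: sqzero_vec_inj; rewrite ?sqzeroE; ring.

(** * Real-valued norms and limits *)

Section RealNorm.
Variables (R : realType) (V : normedModType R[i]).
Implicit Types x y : V.

Definition rnorm x : R := complex.Re `|x|.

Lemma rnormE x : (rnorm x)%:C = `|x|.
Proof. by rewrite /rnorm RRe_real// normr_real. Qed.

Lemma rnorm_ge0 x : 0 <= rnorm x.
Proof. by rewrite -lecR rnormE normr_ge0. Qed.

Lemma rnorm0 : rnorm 0 = 0.
Proof. by rewrite /rnorm normr0. Qed.

Lemma rnorm_le0 x : rnorm x <= 0 -> x = 0.
Proof. by rewrite -lecR rnormE normr_le0 => /eqP. Qed.

Lemma rnorm_gt0 x : x != 0 -> 0 < rnorm x.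
Proof. by rewrite -ltcR rnormE normr_gt0. Qed.

Lemma rnormD x y : rnorm (x + y) <= rnorm x + rnorm y.
Proof. by rewrite -lecR rmorphD /= !rnormE ler_normD. Qed.

Lemma rnormN x : rnorm (- x) = rnorm x.
Proof. by rewrite /rnorm normrN. Qed.

Lemma rnormB x y : rnorm (x - y) <= rnorm x + rnorm y.
Proof. by rewrite -(rnormN y) rnormD. Qed.

Lemma rnorm_distD y x z : rnorm (x - z) <= rnorm (x - y) + rnorm (y - z).
Proof. by rewrite (le_trans _ (rnormD _ _))// addrA addrNK. Qed.

Lemma rnorm_distC x y : rnorm (x - y) = rnorm (y - x).
Proof. by rewrite -rnormN opprB. Qed.

Lemma rnormZ (t : R) x : 0 <= t -> rnorm (t%:C *: x) = t * rnorm x.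
Proof.
move=> t0; apply: complexI.
by rewrite rmorphM /= !rnormE normrZ ger0_norm// lecR.
Qed.

Lemma rnormZi x : rnorm ('i *: x) = rnorm x.
Proof. by rewrite /rnorm normrZ normCi mul1r. Qed.

End RealNorm.

Section LubSequence.
Variable R : realType.
Implicit Types (t : nat -> R) (b : R).

(** For the increasing majorants used below, [b] is the limit of [t], and [b - t n] serves as an
    explicit error bound at stage [n]. *)
Definition lub_seq t b :=
  (forall n, t n <= b) /\ (forall e, 0 < e -> exists n, b - e < t n).

Lemma lub_seq_sup t b : (forall n, t n <= b) -> lub_seq t (sup (range t)).
Proof.
move=> tb; have ht : has_sup (range t).
  by split; [exists (t 0%N), 0%N | exists b => _ [n _ <-]].
split=> [n|e e0]; first by apply: ub_le_sup; [case: ht|exists n].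
by have [_ [n _ <-] tn] := sup_adherent e0 ht; exists n.
Qed.

Lemma lub_seq_squeeze t b (C c : R) :
  lub_seq t b -> 0 <= C -> (forall n, c <= C * (b - t n)) -> c <= 0.
Proof.
move=> [_ tb] C0 cC; rewrite leNgt; apply/negP => c0.
have [n tn] := tb (c / (C + 1)) (divr_gt0 c0 (ltr_wpDl C0 ltr01)).
have := cC n; rewrite leNgt => /negP; apply.
have C1 : 0 < C + 1 by rewrite ltr_wpDl.
have h : b - t n < c / (C + 1) by lra.
rewrite ltr_pdivlMr// in h.
have [?|] := leP (b - t n) 0; last by nra.
by apply: le_lt_trans c0; rewrite mulr_ge0_le0.
Qed.

Lemma lub_seqZ t b (C : R) : 0 <= C -> lub_seq t b ->
  lub_seq (fun n => C * t n) (C * b).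
Proof.
move=> C0 tb; split=> [n|e e0]; first by rewrite ler_wpM2l//; case: tb.
apply: contrapT => /forallNP h.
have /(lub_seq_squeeze tb C0) : forall n, e <= C * (b - t n).
  by move=> n; have := h n; move/negP; rewrite -leNgt mulrBr; lra.
by rewrite leNgt e0.
Qed.

Lemma lub_seq_geometric (rho C : R) : 0 <= rho -> rho < 1 -> 0 <= C ->
  lub_seq (fun n => - (C * rho ^+ n)) 0.
Proof.
move=> r0 r1 C0; split=> [n|e e0].
  by rewrite oppr_le0 mulr_ge0// exprn_ge0.
have /cvgrPdist_lt : geometric C rho @ \oo --> (0 : R).
  by apply: cvg_geometric; rewrite ger0_norm.
move=> /(_ e e0) [n _ /(_ n (leqnn n))] /=.
rewrite sub0r normrN ger0_norm ?mulr_ge0 ?exprn_ge0// => h.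
by exists n; rewrite sub0r ltrN2.
Qed.

End LubSequence.

Section DominatedSequence.
Variables (R : realType) (V : completeNormedModType R[i]).
Variables (x : nat -> V) (t : nat -> R) (b : R).
Hypothesis xt : forall n, rnorm (x n.+1 - x n) <= t n.+1 - t n.
Hypothesis tb : lub_seq t b.

Let tS n : t n <= t n.+1.
Proof. by rewrite -subr_ge0 (le_trans (rnorm_ge0 _) (xt n)). Qed.

Let x_dist m n : (m <= n)%N -> rnorm (x n - x m) <= t n - t m.
Proof.
move=> /subnKC <-; elim: (n - m)%N => [|k IH].
  by rewrite addn0 !subrr rnorm0.
rewrite addnS (le_trans (rnorm_distD (x (m + k)%N) _ _))//.
by have := xt (m + k); lra.
Qed.

(** The majorant principle: telescoping bounds the distance from [x m] to [x n] by [t n - t m], so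
    [x] is Cauchy, and the same bound passes to the limit. *)
Lemma dominated_seq_cvg : exists l, forall n, rnorm (l - x n) <= b - t n.
Proof.
have [tle tlub] := tb.
have cx : cauchy (x @ \oo).
  apply/cauchyP => eps eps0.
  have er : (complex.Re eps)%:C = eps by rewrite RRe_real// gtr0_real.
  have e0 : 0 < complex.Re eps by rewrite -ltcR er.
  have [n tn] := tlub _ e0.
  exists (x n), n => // m /= nm; rewrite -ball_normE /=.
  rewrite -rnormE -er ltcR rnorm_distC.
  by have := x_dist nm; have := tle m; lra.
have /cvg_ex[/= l xl] : cvg (x @ \oo) by exact: cauchy_cvg cx.
exists l => n; apply/ler_addgt0Pr => e e0.
have ec : 0 < e%:C by rewrite ltcR.
have /cvgrPdist_lt/(_ e%:C ec) [N _ hN] := xl.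
have := hN (maxn N n) (leq_maxl _ _); rewrite /= -rnormE ltcR => h.
apply: (le_trans (rnorm_distD (x (maxn N n)) _ _)).
by have := x_dist (leq_maxr N n); have := tle (maxn N n); lra.
Qed.

End DominatedSequence.

(** * Adjointable operators are bounded *)

Lemma conj_real (R : realType) (t : R) : Num.conj t%:C = t%:C :> R[i].
Proof. by apply/CrealP/complex_realP; exists t. Qed.

Section InnerProductBound.
Variables (R : realType) (A : cstarAlgType R) (H : hilbertModType A).
Implicit Types (x y z : H) (T : adjointable H).

Lemma rnorm_ahip x : rnorm (ahip x x) = rnorm x ^+ 2.
Proof. by apply: complexI; rewrite rmorphXn /= !rnormE ahip_norm. Qed.


Lemma ahip_polarization x y : (4 : R)%:C *: ahip x y =
  ahip (x + y) (x + y) - ahip (x - y) (x - y)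
  - 'i *: (ahip (x + 'i *: y) (x + 'i *: y) - ahip (x - 'i *: y) (x - 'i *: y)).
Proof.
have par u : ahip (x + u) (x + u) - ahip (x - u) (x - u) =
    (ahip x u + ahip u x) *+ 2.
  by rewrite !(ahipDl, ahipDr, ahipNl, ahipNr); module.
have -> : (4 : R)%:C = 4%:R :> R[i] by rewrite rmorph_nat.
rewrite !par ahipZr ahipZl conjCi -scalerMnr scalerDr !scalerA mulrN -expr2.
rewrite sqrCi.
by module.
Qed.

(** A crude Cauchy-Schwarz inequality from polarization: each of the four squares is at most
    [(|x| + |y|)^2], so their average is too, and this is 4 for unit vectors. *)
Lemma ahip_norm_le x y : rnorm (ahip x y) <= 4 * rnorm x * rnorm y.
Proof.
have le_sqr x' y' : rnorm (ahip x' y') <= (rnorm x' + rnorm y') ^+ 2.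
  have sq (u v : H) : rnorm u <= rnorm v -> rnorm (ahip (x' + u) (x' + u)) <=
      (rnorm x' + rnorm v) ^+ 2.
    move=> uv; rewrite rnorm_ahip lerXn2r ?nnegrE ?addr_ge0 ?rnorm_ge0//.
    by rewrite (le_trans (rnormD _ _))// lerD2l.
  rewrite -(ler_pM2l (ltr0n R 4)) -rnormZ// ahip_polarization.
  apply: (le_trans (rnormB _ _)); rewrite rnormZi.
  have h1 := rnormB (ahip (x' + y') (x' + y')) (ahip (x' - y') (x' - y')).
  have h2 := rnormB (ahip (x' + 'i *: y') (x' + 'i *: y'))
                    (ahip (x' - 'i *: y') (x' - 'i *: y')).
  have h3 := sq y' y' (lexx _); have h4 := sq (- y') y'.
  have h5 := sq ('i *: y') y'; have h6 := sq (- ('i *: y')) y'.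
  by rewrite !rnormN ?rnormZi !lexx in h4 h5 h6; lra.
have [x0|x0] := eqVneq x 0.
  by rewrite x0 ahip0l !rnorm0 mulr0 mul0r.
have [y0|y0] := eqVneq y 0.
  by rewrite y0 ahip0r !rnorm0 mulr0.
have [{}x0 {}y0] := (rnorm_gt0 x0, rnorm_gt0 y0).
have := le_sqr (((rnorm x)^-1)%:C *: x) (((rnorm y)^-1)%:C *: y).
rewrite ahipZl ahipZr conj_real !rnormZ ?invr_ge0 ?rnorm_ge0//.
rewrite !mulVf ?gt_eqF// mulrA -invfM mulrC ler_pdivrMr ?mulr_gt0//.
by move=> /le_trans; apply; nra.
Qed.

End InnerProductBound.

Definition bounded_by (R : realType) (V : normedModType R[i]) (d : R)
  (T : V -> V) := forall x, rnorm (T x) <= d * rnorm x.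

Section AdjointableBounded.
Variables (R : realType) (A : cstarAlgType R) (H : hilbertModType A).
Implicit Types (x y z : H) (T : adjointable H).

Lemma adj_fun0 T : T 0 = 0.
Proof. by rewrite -[X in T X](scale0r (0 : H)) adj_funZ scale0r. Qed.

(* A gliding hump: were T unbounded, the functionals y |-> <T u_n, y> would   *)
(* have rapidly growing norms for some unit vectors u_n, whereas they are     *)
(* pointwise bounded by 4 |T^* y|; the series of the +- 9^-n T u_n / |T u_n|, *)
(* with suitably chosen signs, sums to a vector contradicting this.           *)
Lemma adj_bounded T : exists2 K : R, 0 < K & bounded_by K T.
Proof.
apply: contrapT => unb.
have big (K : R) : 0 < K -> exists2 u : H, rnorm u = 1 & K < rnorm (T u).
  move=> K0; apply: contrapT => no; apply: unb; exists K => // x.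
  have [->|x0] := eqVneq x 0; first by rewrite adj_fun0 !rnorm0 mulr0.
  have nx := rnorm_gt0 x0.
  rewrite leNgt; apply/negP => xK; apply: no.
  exists (((rnorm x)^-1)%:C *: x).
    by rewrite rnormZ ?invr_ge0 ?rnorm_ge0// mulVf ?gt_eqF.
  by rewrite adj_funZ rnormZ ?invr_ge0 ?rnorm_ge0// mulrC ltr_pdivlMr.
have pow n : 0 < (9 ^+ n : R) by rewrite exprn_gt0.
have /choice[u uP] : forall n : nat, exists u : H,
    rnorm u = 1 /\ n.+1%:R * 9 ^+ n < rnorm (T u).
  by move=> n; have [|u u1 uK] := big (n.+1%:R * 9 ^+ n);
    [rewrite mulr_gt0 ?ltr0n | exists u].
pose nu n := rnorm (T (u n)).
have nu0 n : 0 < nu n.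
  by case: (uP n) => _; apply: le_lt_trans; rewrite mulr_ge0// ltW.
pose r n : R := (9 ^+ n)^-1.
have r0 n : 0 < r n by rewrite invr_gt0.
pose xi n : H := (r n / nu n)%:C *: T (u n).
have xin n : rnorm (xi n) = r n.
  by rewrite rnormZ ?divr_ge0 ?ltW// divfK ?gt_eqF.
have hump n : rnorm (ahip (T (u n)) (xi n)) = r n * nu n.
  rewrite ahipZr rnormZ ?divr_ge0 ?ltW// rnorm_ahip expr2 mulrA.
  by rewrite divfK// gt_eqF.
pose good n (y : H) := r n * nu n <= rnorm (ahip (T (u n)) y).
pose x := fix x n := if n is m.+1 then
  (if good m (x m + xi m) then x m + xi m else x m - xi m) else 0.
have xgood n : good n (x n.+1).
  (* The two candidates differ by [2 xi n], on which the functional has norm [2 r n nu n], so one of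
     them has at least half of that. *)
  rewrite /=; case: ifP => // /negbT; rewrite -ltNge => h1.
  rewrite /good leNgt; apply/negP => h2.
  have := rnormB (ahip (T (u n)) (x n + xi n)) (ahip (T (u n)) (x n - xi n)).
  rewrite -ahipNr -ahipDr.
  have -> : x n + xi n + - (x n - xi n) = (2 : R)%:C *: xi n.
    have -> : (2 : R)%:C = 2%:R :> R[i] by rewrite rmorph_nat.
    by module.
  by rewrite ahipZr rnormZ// hump; lra.
(* The increments of [t] are [9^-n]. With ratio 9 the tail after stage [n] is at most [r n / 8], so
   even with the constant 4 of [ahip_norm_le] it cancels at most half of the hump. *)
pose t n : R := - (9 / 8 * 9^-1 ^+ n).
have tr n : t n.+1 - t n = r n.
  by rewrite /t /r exprS -exprVn; field.
have xt n : rnorm (x n.+1 - x n) <= t n.+1 - t n.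
  rewrite tr /=; case: ifP => _; rewrite [X in rnorm X](addrAC) subrr add0r.
    by rewrite xin.
  by rewrite rnormN xin.
have [|l lx] := dominated_seq_cvg xt (b := 0).
  by apply: lub_seq_geometric; lra.
have lbig n : n.+1%:R <= 8 * rnorm (adj_adj T l).
  have [u1 uK] := uP n.
  have h1 : rnorm (ahip (T (u n)) l) <= 4 * rnorm (adj_adj T l).
    by rewrite adj_funP (le_trans (ahip_norm_le _ _))// u1 mulr1.
  have h2 : rnorm (ahip (T (u n)) (x n.+1 - l)) <= 4 * nu n * (r n / 8).
    apply: (le_trans (ahip_norm_le _ _)).
    apply: ler_wpM2l; first exact: mulr_ge0 (ler0n _ _) (ltW (nu0 n)).
    rewrite rnorm_distC (le_trans (lx n.+1))//.
    suff -> : 0 - t n.+1 = r n / 8 by [].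
    by rewrite /t /r exprS -exprVn; field.
  have h3 := xgood n; rewrite /good in h3.
  have h4 := rnormD (ahip (T (u n)) (x n.+1 - l)) (ahip (T (u n)) l).
  rewrite -ahipDr addrNK in h4.
  have h5 : n.+1%:R < r n * nu n.
    by rewrite mulrC /r ltr_pdivlMr.
  by nra.
have := lbig (Num.truncn (8 * rnorm (adj_adj T l))).
by rewrite leNgt truncnS_gt.
Qed.

(** Completeness of [L(H)] with a rate. Controlling the adjoints as well makes them converge
    pointwise, and the adjunction identity passes to the two limits. *)
Lemma adj_seq_cvg (S : nat -> adjointable H) (t : nat -> R) (b : R) :
  lub_seq t b ->
  (forall n, bounded_by (t n.+1 - t n) (S n.+1 - S n)) ->
  (forall n, bounded_by (t n.+1 - t n) (star (S n.+1) - star (S n))) ->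
  exists T : adjointable H, (forall n, bounded_by (b - t n) (T - S n)) /\
    (forall n, bounded_by (b - t n) (star T - star (S n))).
Proof.
move=> tb St St'.
have lim (U : nat -> adjointable H) :
    (forall n, bounded_by (t n.+1 - t n) (U n.+1 - U n)) ->
    exists f : H -> H, forall n x, rnorm (f x - U n x) <= (b - t n) * rnorm x.
  move=> Ut; suff /choice[f fP] : forall x, exists l, forall n,
      rnorm (l - U n x) <= (b - t n) * rnorm x by exists f.
  move=> x; have [||l lP] :=
    @dominated_seq_cvg _ _ (fun n => U n x) (fun n => rnorm x * t n)
      (rnorm x * b).
  - by move=> n; rewrite -mulrBr mulrC; apply: Ut.
  - by apply: lub_seqZ => //; apply: rnorm_ge0.
  - by exists l => n; rewrite mulrC mulrBr; apply: lP.
have [f fP] := lim S St; have [g gP] := lim (fun n => star (S n)) St'.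
have fg x y : ahip (f x) y = ahip x (g y).
  apply/eqP; rewrite -subr_eq0; apply/eqP/rnorm_le0.
  apply: (@lub_seq_squeeze _ t b (8 * rnorm x * rnorm y)) => //.
    by rewrite !mulr_ge0 ?rnorm_ge0.
  move=> n.
  have -> : ahip (f x) y - ahip x (g y) =
      ahip (f x - S n x) y - ahip x (g y - star (S n) y).
    rewrite ahipDl ahipDr ahipNl ahipNr -[ahip x (star (S n) y)]adj_funP.
    by module.
  apply: (le_trans (rnormB _ _)).
  have h1 := ahip_norm_le (f x - S n x) y.
  have h2 := ahip_norm_le x (g y - star (S n) y).
  have h3 := ler_wpM2r (rnorm_ge0 y) (fP n x).
  have h4 := ler_wpM2l (rnorm_ge0 x) (gP n y).
  by rewrite !mulrA in h3 h4; lra.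
exists (Adjointable fg); split=> n x; [exact: fP|exact: gP].
Qed.

Lemma adj_eq_small (S T : adjointable H) (t : nat -> R) (b C : R) :
  lub_seq t b -> 0 <= C -> (forall n, bounded_by (C * (b - t n)) (S - T)) ->
  S = T.
Proof.
move=> tb C0 ST; apply: adjointable_ext => x; apply/eqP; rewrite -subr_eq0.
apply/eqP/rnorm_le0; apply: (lub_seq_squeeze tb) (mulr_ge0 C0 (rnorm_ge0 x)) _.
by move=> n; rewrite mulrAC; apply: ST.
Qed.

End AdjointableBounded.

(** * Square roots *)

Section StarAlgebraTheory.
Variables (R : realType) (L : starAlgType R).
Implicit Types a b c : L.

Lemma smulNl a b : (- a) *o b = - (a *o b).
Proof. by rewrite -scaleN1r smulZl scaleN1r. Qed.

Lemma smulNr a b : a *o (- b) = - (a *o b).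
Proof. by rewrite -scaleN1r smulZr scaleN1r. Qed.

Lemma smul0l a : 0 *o a = 0.
Proof. by rewrite -[X in X *o a](scale0r (0 : L)) smulZl scale0r. Qed.

Lemma smul0r a : a *o 0 = 0.
Proof. by rewrite -[X in a *o X](scale0r (0 : L)) smulZr scale0r. Qed.

Definition smulE := (@smulDl R L, @smulDr R L, smulNl, smulNr, @smulZl R L,
  @smulZr R L, smul0l, smul0r).

Lemma star_scale (t : R) a : star (t%:C *: a) = t%:C *: star a.
Proof. by rewrite starZ conj_real. Qed.

Definition starE := (@starD R L, @starN R L, star_scale).

End StarAlgebraTheory.

Lemma star_one (R : realType) (L : unitalStarAlgType R) : star sone = sone :> L.
Proof. by rewrite -[LHS]smul1l -{1}[sone]starK -starM smul1l starK. Qed.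

Section BoundedByTheory.
Variables (R : realType) (A : cstarAlgType R) (H : hilbertModType A).
Implicit Types (x y z : H) (S T u v : adjointable H) (d e : R).

Lemma bounded_by_le d e T : d <= e -> bounded_by d T -> bounded_by e T.
Proof.
by move=> de Td x; rewrite (le_trans (Td x))// ler_wpM2r// rnorm_ge0.
Qed.

Lemma bounded_byN d T : bounded_by d T -> bounded_by d (- T).
Proof. by move=> Td x; rewrite /= rnormN. Qed.

Lemma bounded_byD d e S T : bounded_by d S -> bounded_by e T ->
  bounded_by (d + e) (S + T).
Proof.
by move=> Sd Te x; rewrite (le_trans (rnormD _ _))// mulrDl lerD.
Qed.

Lemma bounded_byM d e S T : 0 <= d -> bounded_by d S -> bounded_by e T ->
  bounded_by (d * e) (S *o T).
Proof.
move=> d0 Sd Te x; rewrite (le_trans (Sd (T x)))// -mulrA.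
by apply: ler_wpM2l => //; apply: Te.
Qed.

Lemma bounded_byZ d (k : R) T : 0 <= k -> bounded_by d T ->
  bounded_by (k * d) (k%:C *: T).
Proof. by move=> k0 Td x; rewrite /= rnormZ// -mulrA ler_wpM2l. Qed.

Section SquareRoot.
Variable u : adjointable H.
Hypothesis us : star u = u.
Hypothesis u1 : bounded_by 1 u.

(* The iteration s := (u + s^2) / 2 is dominated by its scalar counterpart.   *)
Let s := fix s n : adjointable H :=
  if n is m.+1 then (2^-1 : R)%:C *: (u + s m *o s m) else 0.
Let t := fix t n : R := if n is m.+1 then 2^-1 * (1 + t m * t m) else 0.

Let sS n : s n.+1 = (2^-1 : R)%:C *: (u + s n *o s n). Proof. by []. Qed.
Let tS n : t n.+1 = 2^-1 * (1 + t n * t n). Proof. by []. Qed.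

Let t01 n : 0 <= t n <= 1.
Proof. by elim: n => [|n /andP[IH0 IH1]]; apply/andP; split=> //=; nra. Qed.

Let st n : bounded_by (t n) (s n) /\ bounded_by (t n.+1 - t n) (s n.+1 - s n).
Proof.
have two : 0 <= (2^-1 : R) by rewrite invr_ge0.
elim: n => [|n [IH1 IH2]].
  split; first by move=> x; rewrite mul0r rnorm0.
  apply: (@bounded_by_le (2^-1 * 1)); first by rewrite /=; lra.
  have -> : s 1%N - s 0%N = (2^-1 : R)%:C *: u.
    by rewrite [s 1%N]/(_ *: (u + 0 *o 0)) smul0l addr0; module.
  exact: bounded_byZ.
have IH3 : bounded_by (t n.+1) (s n.+1).
  have /andP[tn0 _] := t01 n.
  by apply: bounded_byZ => //; apply: bounded_byD => //; apply: bounded_byM.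
split=> //.
have -> : s n.+2 - s n.+1 = (2^-1 : R)%:C *:
    (s n.+1 *o (s n.+1 - s n) + (s n.+1 - s n) *o s n).
  by rewrite sS [X in _ - X = _]sS !smulE; module.
have -> : t n.+2 - t n.+1 =
    2^-1 * (t n.+1 * (t n.+1 - t n) + (t n.+1 - t n) * t n).
  by rewrite tS [X in _ - X = _]tS; ring.
have /andP[tn0 _] := t01 n.+1.
apply: bounded_byZ => //; apply: bounded_byD; apply: bounded_byM => //.
have [/andP[? ?] /andP[? ?]] := (t01 n, t01 n.+1).
by rewrite /=; nra.
Qed.

Let s_star n : star (s n) = s n.
Proof.
by elim: n => [|n IH]; [exact: star0|rewrite sS !starE us starM IH].
Qed.

Let s_comm v n : v *o u = u *o v -> v *o s n = s n *o v.
Proof.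
move=> vu; elim: n => [|n IH]; first by rewrite !smulE.
by rewrite sS !smulE vu smulA IH -smulA IH smulA.
Qed.

(** The limit [S] of the iteration satisfies [2 S = u + S^2], so [r = 1 - S] squares to [1 - u]. The
    bound on [1 - r] lets the lemma be applied again, to a root of [r]. *)
Lemma adj_sqrt : exists r : adjointable H,
  [/\ star r = r, r *o r = sone - u, bounded_by 1 (sone - r) &
      forall v, v *o u = u *o v -> v *o r = r *o v].
Proof.
have tb : lub_seq t (sup (range t)).
  by apply: (@lub_seq_sup _ _ 1) => n; case/andP: (t01 n).
set b := sup _ in tb; have [tb1 _] := tb.
have b1 : b <= 1.
  by apply: ge_sup; [exists 0, 0%N|move=> _ [n _ <-]; case/andP: (t01 n)].
have [||S [Ss Ss']] := adj_seq_cvg tb (S := s).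
- by move=> n; case: (st n).
- by move=> n; rewrite !s_star; case: (st n).
have S1 : bounded_by 1 S.
  apply: bounded_by_le b1 _; have := Ss 0%N.
  by rewrite [t 0%N]/(0) [s 0%N]/(0) !subr0.
have s1 n : bounded_by 1 (s n).
  by apply: bounded_by_le (proj1 (st n)); case/andP: (t01 n).
have SS : star S = S.
  apply: (adj_eq_small tb (C := 2)) => // n.
  have -> : star S - S = (star S - star (s n)) - (S - s n).
    by rewrite s_star; module.
  apply: (@bounded_by_le ((b - t n) + (b - t n))); first by lra.
  by apply: bounded_byD => //; apply: bounded_byN.
have SE : (2 : R)%:C *: S = u + S *o S.
  apply: (adj_eq_small tb (C := 4)) => // n.
  have -> : (2 : R)%:C *: S - (u + S *o S) = (2 : R)%:C *: (S - s n.+1)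
      - (S *o (S - s n) + (S - s n) *o s n).
    have -> : (2 : R)%:C *: (S - s n.+1) =
        (2 : R)%:C *: S - (u + s n *o s n).
      by rewrite scalerBr /= scalerA -rmorphM mulfV ?pnatr_eq0// scale1r.
    by rewrite !smulE; module.
  apply: (@bounded_by_le (2 * (b - t n.+1) + (1 * (b - t n) + (b - t n) * 1))).
    have /andP[tn0 tn1] := t01 n; rewrite /=; nra.
  apply: bounded_byD; first by apply: bounded_byZ.
  apply: bounded_byN; apply: bounded_byD; apply: bounded_byM => //.
  by rewrite subr_ge0.
have Scomm v : v *o u = u *o v -> v *o S = S *o v.
  move=> vu; have [K K0 vK] := adj_bounded v.
  apply: (adj_eq_small tb (C := 2 * K)) => [|n].
    by rewrite mulr_ge0// ltW.
  have -> : v *o S - S *o v = v *o (S - s n) - (S - s n) *o v.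
    by rewrite !smulE (s_comm n vu); module.
  apply: (@bounded_by_le (K * (b - t n) + (b - t n) * K)); first by lra.
  apply: bounded_byD; first by apply: bounded_byM => //; apply: ltW.
  by apply: bounded_byN; apply: bounded_byM => //; rewrite subr_ge0.
exists (sone - S); split.
- by rewrite !starE star_one SS.
- rewrite !smulE !smul1l !smul1r.
  have -> : S *o S = (2 : R)%:C *: S - u by rewrite SE; module.
  have -> : (2 : R)%:C = 2%:R :> R[i] by rewrite rmorph_nat.
  by module.
- by rewrite opprB addrC addrNK.
- by move=> v /Scomm vS; rewrite !smulE smul1l smul1r vS.
Qed.

End SquareRoot.

End BoundedByTheory.

(** * Faithful representations reflect norm bounds *)

Section BoundedOpTheory.
Variables (R : realType) (X : hilbertType R).
Implicit Types (x y : X) (S T p c : bounded_op X) (d : R).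

Lemma rnorm_hip x : (rnorm x ^+ 2)%:C = hip x x.
Proof. by rewrite rmorphXn /= rnormE hip_norm. Qed.

Lemma bop_hip_star T x y : hip x (T y) = hip (star T x) y.
Proof.
by have := bop_starP (star T) x y; rewrite -[bop_star _]/(star (star T)) starK.
Qed.

Lemma bopN T x : T (- x) = - T x.
Proof. by rewrite -scaleN1r bopZ scaleN1r. Qed.

Lemma bop_rbound T : exists2 K : R, 0 < K & bounded_by K T.
Proof.
have [K K0 TK] := bop_bound T.
have KE : (complex.Re K)%:C = K by rewrite RRe_real// ger0_real.
have K0' : 0 <= complex.Re K by rewrite -lecR KE.
exists (complex.Re K + 1); first by rewrite ltr_wpDl.
move=> x; apply: (@le_trans _ _ (complex.Re K * rnorm x)).
  by rewrite -lecR rmorphM /= KE !rnormE.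
by rewrite ler_wpM2r ?rnorm_ge0// lerDl.
Qed.

Lemma rnorm_le_hip x y z (C : R) : 0 <= C -> hip x x = hip y z ->
  rnorm y * rnorm z <= C * rnorm x -> rnorm x <= C.
Proof.
move=> C0 xyz yzC; have [->|x0] := eqVneq x 0; first by rewrite rnorm0.
have nx := rnorm_gt0 x0.
rewrite -(ler_pM2r nx) -expr2 (le_trans _ yzC)//.
have := hip_norm_le y z; rewrite -xyz -rnorm_hip -!rnormE -rmorphM.
by rewrite ger0_norm lecR// exprn_ge0// rnorm_ge0.
Qed.

Lemma bop_star_bounded d T : 0 <= d -> bounded_by d T -> bounded_by d (star T).
Proof.
move=> d0 Td x; apply: (@rnorm_le_hip _ (T (star T x)) x).
- by rewrite mulr_ge0// rnorm_ge0.
- exact/esym/(bop_starP T).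
- by rewrite mulrAC ler_wpM2r ?rnorm_ge0.
Qed.

(** With [q = c^2], every [y = (p - q) x] satisfies [(p + q) y = 0], since [p] and [q] commute and
    have equal squares. By positivity [<y, q y> = |c y|^2] vanishes, so [q y = p y = 0]; thus the
    self-adjoint [p - q] has square zero. *)
Lemma bop_sqrt_unique p c : star p = p -> star c = c ->
  (forall x, 0 <= hip x (p x)) ->
  p *o p = (c *o c) *o (c *o c) -> p *o (c *o c) = (c *o c) *o p ->
  p = c *o c.
Proof.
move=> ps cs p0 pq pqC; set q := c *o c in pq pqC *.
have qs : star q = q by rewrite starM cs.
have D2 x : (p - q) ((p - q) x) = 0.
  set y := (p - q) x.
  have py : p y = - q y.
    have appM S T z : S (T z) = (S *o T) z by [].
    rewrite /y -[(p - q) x]/(p x - q x) !(bopD, bopN) !appM.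
    by rewrite pq pqC; module.
  have cy : c y = 0.
    have : hip y (p y) + hip y (q y) = 0 by rewrite py hipNr addNr.
    move=> /eqP; rewrite paddr_eq0// => [/andP[_]|].
      rewrite -[q y]/(c (c y)) bop_hip_star cs -hip_norm sqrf_eq0 normr_eq0.
      by move=> /eqP.
    by rewrite -[q y]/(c (c y)) bop_hip_star cs -hip_norm exprn_ge0.
  have qy : q y = 0 by rewrite -(bop0 c) -cy.
  by rewrite -[LHS]/(p y - q y) py qy !oppr0 addr0.
apply: bop_ext => x; apply/eqP; rewrite -subr_eq0 -normr_eq0 -sqrf_eq0.
have -> : p x - q x = (p - q) x by [].
have sD : star (p - q) = p - q by rewrite !starE ps qs.
by rewrite hip_norm -{1}sD -bop_hip_star D2 hip0r.
Qed.

End BoundedOpTheory.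

Section NormReflection.
Variables (R : realType) (A : cstarAlgType R) (H : hilbertModType A).
Implicit Types (x y z : H) (a b c w T : adjointable H) (d : R).

Lemma adj_scaled_isometry w d : 0 <= d ->
  star w *o w = (d * d)%:C *: sone -> forall x, rnorm (w x) = d * rnorm x.
Proof.
move=> d0 wd x; apply/eqP.
rewrite -(@eqrXn2 _ 2) ?rnorm_ge0 ?mulr_ge0 ?rnorm_ge0//.
rewrite -rnorm_ahip adj_funP -[adj_adj w (w x)]/((star w *o w) x) wd.
by rewrite ahipZr rnormZ ?mulr_ge0// rnorm_ahip -expr2 exprMn.
Qed.

(** As [a] and [c] commute, [w = a + i c] and its adjoint both scale norms by exactly [d], and [2 a]
    is their sum. *)
Lemma adj_sum_squares_bounded a c d : star a = a -> star c = c ->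
  a *o c = c *o a -> a *o a + c *o c = (d * d)%:C *: sone -> 0 <= d ->
  bounded_by d a.
Proof.
move=> sa sc ac aacc d0; pose w := a + 'i *: c.
have sw : star w = a - 'i *: c by rewrite !(starD, starZ) sa sc conjCi scaleNr.
have ii : 'i *: ('i *: (c *o c)) = - (c *o c) :> adjointable H.
  by rewrite scalerA -expr2 sqrCi scaleN1r.
have ww : star w *o w = (d * d)%:C *: sone.
  by rewrite sw -aacc !smulE ii ac; module.
have ww' : star (star w) *o star w = (d * d)%:C *: sone.
  by rewrite starK sw -aacc !smulE ii ac; module.
move=> x; have := rnormD (w x) (star w x).
rewrite (adj_scaled_isometry d0 ww) (adj_scaled_isometry d0 ww').
have -> : w x + star w x = (2 : R)%:C *: a x.
  have -> : (2 : R)%:C = 2%:R :> R[i] by rewrite rmorph_nat.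
  by rewrite sw -[LHS]/(a x + 'i *: c x + (a x - 'i *: c x)); module.
by rewrite rnormZ//; lra.
Qed.

Variables (X : hilbertType R) (pi : adjointable H -> bounded_op X).
Hypothesis pi_morph : representation pi.
Hypothesis pi_inj : faithful pi.
Hypothesis pi1 : unital pi.

Lemma repD a b : pi (a + b) = pi a + pi b.
Proof. by have := star_morph_linear pi_morph 1 a b; rewrite !scale1r. Qed.

Lemma rep0 : pi 0 = 0.
Proof. by apply: (addrI (pi 0)); rewrite -repD !addr0. Qed.

Lemma repZ (k : R[i]) a : pi (k *: a) = k *: pi a.
Proof. by have := star_morph_linear pi_morph k a 0; rewrite rep0 !addr0. Qed.

Lemma repN a : pi (- a) = - pi a.
Proof. by rewrite -scaleN1r repZ scaleN1r. Qed.

Let repM := star_morphM pi_morph.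
Let repS := star_morph_star pi_morph.
Let repE := (repD, repN, repZ, repM, repS, pi1).

(* The positive element d^2 - pi a^2 is the image of a square, because        *)
(* positive square roots are unique in B(X): so d^2 = a^2 + c^2 for some c    *)
(* commuting with a, and a is the real part of d times the unitary            *)
(* (a + i c) / d.                                                             *)
Lemma faithful_bounded_sa a d : star a = a -> 0 <= d ->
  bounded_by d (pi a) -> bounded_by d a.
Proof.
move=> sa d0 ad; pose z0 := (d * d)%:C *: sone - a *o a.
have [K K0 z0K] := adj_bounded z0.
have nK : 0 <= K^-1 by rewrite invr_ge0 ltW.
pose z := (K^-1)%:C *: z0.
have z1 : bounded_by 1 z by rewrite -(mulVf (lt0r_neq0 K0)); apply: bounded_byZ.
have sz : star z = z by rewrite !starE star_one starM sa.
have zz1 : bounded_by 1 (z *o z).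
  by rewrite -(mulr1 1); apply: bounded_byM.
(* Three roots are taken: [e^2 = 1 - z^2], then [r^2 = 1 - e^2 = z^2], so that [r] plays the role of
   [|z|], then [c^2 = r]. Positivity of [pi z] will force [r = z]. *)
have [|e [se ee _ e_comm]] := adj_sqrt _ zz1; first by rewrite starM sz.
have ze : z *o e = e *o z by apply: e_comm; rewrite smulA.
have e1 : bounded_by 1 e.
  apply: (adj_sum_squares_bounded se sz) => //.
  by rewrite ee mulr1 scale1r addrNK.
have ee1 : bounded_by 1 (e *o e).
  by rewrite -(mulr1 1); apply: bounded_byM.
have [|r [sr rr r1 r_comm]] := adj_sqrt _ ee1; first by rewrite starM se.
have [|c [sc cc _ c_comm]] := adj_sqrt _ r1.
  by rewrite !starE star_one sr.
rewrite opprB addrC addrNK in cc.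
have comm2 v w : v *o w = w *o v -> v *o (w *o w) = (w *o w) *o v.
  by move=> vw; rewrite smulA vw -smulA vw smulA.
have zr : z *o r = r *o z by apply/r_comm/comm2.
have rz : pi r = pi z.
  rewrite -cc repM; apply/esym/bop_sqrt_unique.
  - by rewrite -repS sz.
  - by rewrite -repS sc.
  - move=> x; rewrite !repE.
    rewrite -[X in hip x X]/((K^-1)%:C *: ((d * d)%:C *: x - pi a (pi a x))).
    rewrite hipZr hipDr hipZr hipNr bop_hip_star -repS sa -!rnorm_hip.
    rewrite -rmorphM -rmorphB -rmorphM lecR mulr_ge0// subr_ge0.
    by rewrite -expr2 -exprMn lerXn2r ?nnegrE ?mulr_ge0 ?rnorm_ge0.
  - by rewrite -!repM cc rr ee; congr pi; module.
  - by rewrite -!repM cc zr.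
have {}cc : c *o c = z by rewrite cc; apply: pi_inj.
have az : a *o z = z *o a.
  by rewrite !smulE smul1l smul1r smulA.
have ac : a *o c = c *o a.
  apply: c_comm; rewrite !smulE smul1l smul1r; congr (_ - _).
  by apply/r_comm/comm2/e_comm/comm2.
(* This undoes the scaling: [c1^2 = K z = z0 = d^2 - a^2]. *)
pose c1 := (Num.sqrt K)%:C *: c.
apply: (@adj_sum_squares_bounded a c1) => //.
- by rewrite star_scale sc.
- by rewrite !smulE ac.
- rewrite !smulE scalerA -rmorphM -expr2 sqr_sqrtr ?ltW// cc.
  rewrite scalerA -rmorphM mulfV ?gt_eqF// scale1r.
  by module.
Qed.

(** The factor 2 comes from splitting [T = a + i b] into self-adjoint parts, each bounded by [d]
    through its image. *)
Lemma faithful_bounded T d : 0 <= d ->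
  bounded_by d (pi T) -> bounded_by (2 * d) T.
Proof.
move=> d0 Td; have Td' := bop_star_bounded d0 Td.
have h0 : 0 <= (2^-1 : R) by rewrite invr_ge0.
pose a := (2^-1 : R)%:C *: (T + star T).
pose b := (2^-1 : R)%:C *: ('i *: (star T - T)).
have ad : bounded_by d a.
  apply: faithful_bounded_sa => //.
    by rewrite !starE starK addrC.
  move=> x; rewrite !repE.
  rewrite -[X in rnorm X]/(_ *: (pi T x + star (pi T) x)) rnormZ//.
  by have := rnormD (pi T x) (star (pi T) x); have := Td x; have := Td' x; lra.
have bd : bounded_by d b.
  apply: faithful_bounded_sa => //.
    by rewrite !(starE, starZ) conjCi starK; module.
  move=> x; rewrite !repE.
  rewrite -[X in rnorm X]/(_ *: ('i *: (star (pi T) x - pi T x))) rnormZ//.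
  rewrite rnormZi.
  by have := rnormB (star (pi T) x) (pi T x); have := Td x; have := Td' x; lra.
have ib : 'i *: b = - ((2^-1 : R)%:C *: (star T - T)).
  by rewrite scalerA mulrC -scalerA (scalerA 'i) -expr2 sqrCi scaleN1r scalerN.
have TE : T = a + 'i *: b.
  have hh : (2^-1 : R)%:C + (2^-1 : R)%:C = 1 :> R[i].
    by rewrite -rmorphD; have -> : 2^-1 + 2^-1 = 1 :> R by lra.
  by rewrite ib -[LHS]scale1r -hh /a; module.
move=> x; rewrite {1}TE -[X in rnorm X]/(a x + 'i *: b x).
have := rnormD (a x) ('i *: b x); rewrite rnormZi.
by have := ad x; have := bd x; lra.
Qed.

End NormReflection.

(** * Regularity *)

(** On the range of [F^*] one has [y = F^* W^* y], so [|y|^2 = <F y, W^* y>] and [|y| <= om |F y|].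
    With [tau = om^-2], expanding [|y - tau F^* F y|^2] leaves at most [|y|^2 - tau |F y|^2], hence
    at most [(1 - tau^2) |y|^2]. *)
Lemma bop_landweber_contraction (R : realType) (X : hilbertType R)
    (F W : bounded_op X) (om : R) :
  1 <= om -> bounded_by om F -> bounded_by om W -> F *o W *o F = F ->
  exists rho : R, [/\ 0 <= rho, rho < 1 & forall v,
    rnorm (star F v - (om ^- 2)%:C *: star F (F (star F v))) <=
    rho * rnorm (star F v)].
Proof.
move=> om1 Fom Wom FWF; have om0 : 0 < om by rewrite (lt_le_trans _ om1).
have [om0' om20] := (ltW om0, exprn_gt0 2 om0).
pose tau := om ^- 2; have tau0 : 0 < tau by rewrite invr_gt0.
have tau_om : tau * om ^+ 2 = 1 by rewrite mulVf// gt_eqF.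
pose rho := Num.sqrt (1 - tau ^+ 2).
exists rho; split; first exact: sqrtr_ge0.
  rewrite -[ltRHS]sqrtr1 ltr_sqrt//.
  by rewrite gtrBl exprn_gt0.
move=> v; set y := star F v.
have yE : y = star F (star W y).
  by rewrite /y -{1}FWF !starM.
have yF : rnorm y <= om * rnorm (F y).
  apply: (@rnorm_le_hip _ _ _ (F y) (star W y)).
  - exact: mulr_ge0 om0' (rnorm_ge0 _).
  - by have := congr1 (hip y) yE; rewrite bop_hip_star starK.
  - rewrite mulrAC [leLHS]mulrC ler_wpM2r ?rnorm_ge0//.
    exact: (bop_star_bounded om0' Wom).
set f := rnorm (F y) in yF.
have fF : rnorm (star F (F y)) <= om * f by exact: (bop_star_bounded om0' Fom).
have sq : rnorm (y - tau%:C *: star F (F y)) ^+ 2 =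
    rnorm y ^+ 2 - 2 * tau * f ^+ 2 + tau ^+ 2 * rnorm (star F (F y)) ^+ 2.
  apply: complexI.
  rewrite rmorphXn /= rnormE -scaleNr -rmorphN norm_sqrDZ bop_hip_star starK.
  rewrite -rnorm_hip -rmorphM conj_real real_normK; last first.
    by apply/complex_realP; exists (- tau).
  rewrite -!rnormE -!(rmorphXn, rmorphM, rmorphD); congr (_%:C).
  by rewrite -/f; ring.
have fy : 0 <= f := rnorm_ge0 _.
have ny : 0 <= rnorm y := rnorm_ge0 _.
have F2 : rnorm (star F (F y)) ^+ 2 <= om ^+ 2 * f ^+ 2.
  by rewrite -exprMn lerXn2r ?nnegrE ?mulr_ge0 ?rnorm_ge0.
have y2 : tau * rnorm y ^+ 2 <= f ^+ 2.
  rewrite -[leRHS]mul1r -tau_om -mulrA (ler_wpM2l (ltW tau0))// -exprMn.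
  by rewrite lerXn2r ?nnegrE ?mulr_ge0 ?rnorm_ge0.
rewrite -(@ler_pXn2r _ 2) ?nnegrE ?mulr_ge0 ?rnorm_ge0 ?sqrtr_ge0// sq exprMn.
rewrite sqr_sqrtr.
  have h1 := ler_wpM2l (ltW (exprn_gt0 2 tau0)) F2.
  have h2 : tau ^+ 2 * (om ^+ 2 * f ^+ 2) = tau * f ^+ 2.
    by rewrite expr2 -mulrA [tau * (om ^+ 2 * _)]mulrA tau_om mul1r.
  have h3 := ler_wpM2l (ltW tau0) y2.
  by rewrite mulrA -expr2 in h3; lra.
rewrite subr_ge0; apply: exprn_ile1; first exact: ltW.
by rewrite invf_le1// exprn_ege1.
Qed.

Section Regularity.
Variables (R : realType) (A : cstarAlgType R) (H : hilbertModType A).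
Variables (X : hilbertType R) (pi : adjointable H -> bounded_op X).
Hypothesis pi_morph : representation pi.
Hypothesis pi_inj : faithful pi.
Hypothesis pi1 : unital pi.
Let repM := star_morphM pi_morph.
Let repS := star_morph_star pi_morph.
Let repE := (repD pi_morph, repN pi_morph, repZ pi_morph, repM, repS, pi1).

(* The Landweber iteration K := K + tau (1 - K T) T^* converges to a          *)
(* generalized inverse, because 1 - tau T^* T contracts the range of T^*.     *)
Lemma faithful_regular (T : adjointable H) (W : bounded_op X) :
  pi T *o W *o pi T = pi T -> exists K : adjointable H, T *o K *o T = T.
Proof.
move=> FWF; set F := pi T in FWF.
have [om [om1 Fom Wom]] :
    exists om : R, [/\ 1 <= om, bounded_by om F & bounded_by om W].
  have [[k k0 Fk] [l l0 Wl]] := (bop_rbound F, bop_rbound W).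
  exists (k + l + 1); split=> [|x|x]; first by lra.
    by rewrite (le_trans (Fk x))// ler_wpM2r ?rnorm_ge0//; lra.
  by rewrite (le_trans (Wl x))// ler_wpM2r ?rnorm_ge0//; lra.
have [rho [rho0 rho1 contr]] := bop_landweber_contraction om1 Fom Wom FWF.
set tau := om ^- 2 in contr.
have om0 : 0 < om by rewrite (lt_le_trans _ om1).
have tau0 : 0 < tau by rewrite invr_gt0 exprn_gt0.
pose a := sone - tau%:C *: (star T *o T).
have sa : star a = a by rewrite !starE star_one starM starK.
pose An := fix An n : adjointable H := if n is m.+1 then a *o An m else sone.
pose K := fix K n : adjointable H :=
  if n is m.+1 then K m + tau%:C *: (An m *o star T) else 0.
have AS n : An n.+1 = a *o An n by [].
have KS n : K n.+1 = K n + tau%:C *: (An n *o star T) by [].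
have AC n : An n *o a = a *o An n.
  elim: n => [|n IH]; first by rewrite smul1l smul1r.
  by rewrite AS -smulA IH.
have sA n : star (An n) = An n.
  by elim: n => [|n IH]; [exact: star_one|rewrite AS starM IH sa AC].
(* The contraction holds only on the range of [F^*], so each iterate is exhibited as some
   [star F v']. *)
have AF n v : exists2 v', pi (An n) (star F v) = star F v' &
    rnorm (star F v') <= rho ^+ n * rnorm (star F v).
  elim: n => [|n [v' Av' nv']].
    by exists v; [rewrite [pi (An 0%N)]pi1|rewrite expr0 mul1r].
  exists (v' - tau%:C *: F (star F v')).
    rewrite AS repM -[LHS]/(pi a (pi (An n) (star F v))) Av' !repE.
    by rewrite bopD bopN bopZ.
  rewrite bopD bopN bopZ (le_trans (contr v'))// exprS -mulrA.
  by rewrite ler_wpM2l.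
have AT n : bounded_by (rho ^+ n * om) (pi (An n *o star T)).
  move=> v; rewrite repM repS.
  have [v' AF' nv'] := AF n v.
  rewrite -[X in rnorm X]/(pi (An n) (star F v)) AF' (le_trans nv')// -mulrA.
  by rewrite ler_wpM2l ?exprn_ge0// bop_star_bounded// ltW.
have rom n : 0 <= rho ^+ n * om by rewrite mulr_ge0 ?exprn_ge0// ltW.
have AT1 n : bounded_by (2 * (rho ^+ n * om)) (An n *o star T).
  by apply: (faithful_bounded pi_morph pi_inj pi1).
have AT2 n : bounded_by (2 * (rho ^+ n * om)) (T *o An n).
  apply: (faithful_bounded pi_morph pi_inj pi1) => //.
  have -> : T *o An n = star (An n *o star T) by rewrite starM starK sA.
  by rewrite repS; apply: bop_star_bounded.
have KT n : K n *o T = sone - An n.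
  elim: n => [|n IH]; first by rewrite smul0l subrr.
  rewrite KS AS -AC /a !smulE IH smul1r -smulA; module.
(* Chosen so that the increments of [t] are the bounds [2 tau rho^n om] on the increments of [K]. *)
pose C := 2 * tau * om / (1 - rho).
have C0 : 0 < C by rewrite divr_gt0 ?subr_gt0// !mulr_gt0.
pose t n := - (C * rho ^+ n).
have tb : lub_seq t 0 by apply: lub_seq_geometric => //; apply: ltW.
have tS n : t n.+1 - t n = tau * (2 * (rho ^+ n * om)).
  by rewrite /t /C exprS; field; rewrite subr_eq0 gt_eqF.
have KSB n : K n.+1 - K n = tau%:C *: (An n *o star T) by rewrite KS; module.
have [||V [VK _]] := adj_seq_cvg tb (S := K).
- by move=> n; rewrite KSB tS; apply: bounded_byZ => //; apply: ltW.
- move=> n; rewrite -starN -starD KSB tS star_scale starM starK sA.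
  by apply: bounded_byZ => //; apply: ltW.
exists V.
have [k k0 Tk] := adj_bounded T.
apply: (adj_eq_small tb (C := k * k + (1 - rho) / tau)) => [|n].
  by rewrite addr_ge0 ?divr_ge0 ?mulr_ge0 ?subr_ge0 ?ltW.
(* From [K n T = 1 - An n]. The last term is small because it is the adjoint of [An n T^*]. *)
have -> : T *o V *o T - T = T *o ((V - K n) *o T) - T *o An n.
  have -> : T *o An n = T - T *o (K n *o T).
    by rewrite KT !smulE smul1r; module.
  by rewrite !smulE smulA; module.
apply: (@bounded_by_le _ _ _ (k * ((0 - t n) * k) + 2 * (rho ^+ n * om))).
  suff : 2 * (rho ^+ n * om) = (1 - rho) / tau * (0 - t n) by lra.
  rewrite /t /C; field.
  by rewrite subr_eq0 gt_eqF//= gt_eqF.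
apply: bounded_byD; last exact: bounded_byN.
apply: bounded_byM; first exact: ltW.
  exact: Tk.
apply: bounded_byM => //.
by case: tb => tle _; rewrite subr_ge0.
Qed.

(** Spectral permanence out of regularity: an inner inverse of an element whose image is invertible
    must be its inverse. *)
Lemma faithful_invertible (S : adjointable H) (V : bounded_op X) :
  pi S *o V = sone -> V *o pi S = sone ->
  exists2 S' : adjointable H, S *o S' = sone & pi S' = V.
Proof.
move=> SV VS.
have [|K SKS] := @faithful_regular S V; first by rewrite SV smul1l.
have SK : S *o K = sone.
  apply: pi_inj; rewrite pi1 -[LHS]smul1r -SV smulA -repM.
  by rewrite SKS.
exists K => //.
by rewrite -[LHS]smul1l -VS -smulA -repM SK pi1 smul1r.
Qed.

End Regularity.

(** * Weighted Moore-Penrose inverses *)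

(** The two self-adjointness conditions say that [A W] and [W A] equal their own weighted adjoints
    [M^-1 (A W)^* M] and [N^-1 (W A)^* N], which are [Q P] and [P Q]. *)
Lemma weighted_adjoint (R : realType) (L : unitalStarAlgType R)
    (M N A W Mi Ni : L) :
  star M = M -> star N = N -> M *o Mi = sone -> Mi *o M = sone ->
  N *o Ni = sone -> Ni *o N = sone -> is_wmp_inverse M N A W ->
  let P := Ni *o star A *o M in let Q := Mi *o star W *o N in
  [/\ P *o Q = W *o A, Q *o P = A *o W & Q *o P *o Q = Q].
Proof.
move=> sM sN MMi MiM NNi NiN [AWA WAW sMAW sNWA] P Q.
rewrite /self_adjoint in sMAW sNWA.
have AWM : star (A *o W) *o M = M *o (A *o W).
  by rewrite -{1}sM -starM smulA sMAW.
have WAN : star (W *o A) *o N = N *o (W *o A).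
  by rewrite -{1}sN -starM smulA sNWA.
have PQ : P *o Q = Ni *o star (W *o A) *o N.
  by rewrite /P /Q !smulA -[_ *o M *o Mi]smulA MMi smul1r starM !smulA.
have QP : Q *o P = Mi *o star (A *o W) *o M.
  by rewrite /P /Q !smulA -[_ *o N *o Ni]smulA NNi smul1r starM !smulA.
split.
- by rewrite PQ -smulA WAN smulA NiN smul1l.
- by rewrite QP -smulA AWM smulA MiM smul1l.
- rewrite QP /Q !smulA -[_ *o M *o Mi]smulA MMi smul1r.
  by rewrite -[_ *o star _ *o star _]smulA -starM smulA WAW.
Qed.

(* P and Q are the adjoints of A and W for the indefinite inner products      *)
(* defined by the weights. Even when P A is not invertible, P A + (1 - K A)   *)
(* is, with inverse V, and this makes W a word in A, P and V.                 *)
Lemma regular_wmp_algebra (R : realType) (L : unitalStarAlgType R)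
    (A P W Q K : L) :
  A *o W *o A = A -> W *o A *o W = W -> Q *o P *o Q = Q ->
  P *o Q = W *o A -> Q *o P = A *o W -> A *o K *o A = A ->
  exists V : L, [/\ (P *o A + (sone - K *o A)) *o V = sone,
    V *o (P *o A + (sone - K *o A)) = sone & P *o A *o V *o V *o P = W].
Proof.
move=> AWA WAW QPQ PQ QP AKA.
have [e eE] : exists e, e = sone - K *o A by exists (sone - K *o A).
(* [G] is the group inverse of [B], with [p] as the common idempotent. Unlike [1 - p], the
   complement [e = 1 - K A] does not involve [W], so in the application it comes from [L(H)]. *)
rewrite -eE; set B := P *o A; pose G := W *o Q; pose p := W *o A.
have Ae : A *o e = 0 by rewrite eE !smulE smul1r smulA AKA subrr.
have BG : B *o G = p.
  by rewrite /B /G -smulA [A *o _]smulA -QP 2!smulA PQ -smulA PQ smulA WAW.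
have GB : G *o B = p.
  by rewrite /B /G -smulA [Q *o _]smulA QP AWA.
have Bp : B *o p = B by rewrite /B /p -smulA [A *o (_ *o _)]smulA AWA.
have pB : p *o B = B by rewrite /B /p -PQ -smulA [Q *o _]smulA QP AWA.
have pG : p *o G = G by rewrite /p /G smulA WAW.
have Gp : G *o p = G by rewrite /G /p -PQ -smulA [Q *o (_ *o _)]smulA QPQ.
have pp : p *o p = p by rewrite /p smulA WAW.
have pe : p *o e = 0 by rewrite /p -smulA Ae smul0r.
have Be : B *o e = 0 by rewrite /B -smulA Ae smul0r.
have Ge : G *o e = 0 by rewrite -Gp -smulA pe smul0r.
have ee : e *o e = e.
  by rewrite {1}eE !smulE smul1l -smulA Ae smul0r oppr0 addr0.
have ep : e *o p = e - sone + p.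
  rewrite eE !smulE smul1l -smulA /p [A *o (_ *o _)]smulA AWA; module.
have GP : G *o P = W by rewrite /G -smulA QP smulA.
(* The correction [- e G] makes [e V = 1 - p], which complements [B V = p]. Since [p V = G], the
   word [B V V P] is [G P = W]. *)
clearbody B G p; pose V := G + (sone - p) - e *o G.
have BV : B *o V = p.
  by rewrite /V !smulE smul1r smulA BG Bp Be smul0l; module.
exists V; split.
- rewrite smulDl BV /V !smulE smul1r smulA ep ee; module.
- rewrite /V !smulE !smul1l -!smulA GB Ge pB pe smul0r ep; module.
- have pV : p *o V = G.
    by rewrite /V !smulE smul1r smulA pG pp pe smul0l; module.
  by rewrite BV pV.
Qed.

Theorem theorem4p4 (R : realType) (A : cstarAlgType R) (H : hilbertModType A)
    (X : hilbertType R) (pi : adjointable H -> bounded_op X) :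
  representation pi -> faithful pi -> unital pi ->
  forall M N T : adjointable H, weight M -> weight N ->
    ((exists Z : adjointable H, is_wmp_inverse M N T Z) <->
     (exists W : bounded_op X, is_wmp_inverse (pi M) (pi N) (pi T) W)) /\
    (forall (Z : adjointable H) (W : bounded_op X),
       is_wmp_inverse M N T Z ->
       is_wmp_inverse (pi M) (pi N) (pi T) W ->
       W = pi Z).
Proof.
move=> pi_morph pi_inj pi1 M N T wM wN.
have repM := star_morphM pi_morph; have repS := star_morph_star pi_morph.
have repE := (repD pi_morph, repN pi_morph, repM, repS, pi1).
have pi_weight S : weight S -> weight (pi S).
  move=> [sS [Si [SSi SiS]]]; split; first by rewrite /self_adjoint -repS sS.
  by exists (pi Si); rewrite -!repM SSi SiS pi1.
have pi_wmp Z : is_wmp_inverse M N T Z <->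
    is_wmp_inverse (pi M) (pi N) (pi T) (pi Z).
  rewrite /is_wmp_inverse /self_adjoint -!repM -!repS.
  by split=> -[h1 h2 h3 h4]; split; first [exact: pi_inj|congr pi].
split; last first.
  move=> Z W /pi_wmp hZ hW.
  exact: (wmp_inverse_unique (pi_weight _ wM) (pi_weight _ wN) hW hZ).
split=> [[Z /pi_wmp hZ]|[W hW]]; first by exists (pi Z).
(* Injectivity reflects the equations, so only membership of [W] in the range of [pi] is at
   stake. *)
suff [Z ZW] : exists Z, pi Z = W by exists Z; apply/pi_wmp; rewrite ZW.
have [FWF WFW _ _] := hW.
have [[sM [Mi [MMi MiM]]] [sN [Ni [NNi NiN]]]] := (wM, wN).
have [K TKT] := faithful_regular pi_morph pi_inj pi1 FWF.
(* [P] is formed in [L(H)], whereas [Q] involves [W] and exists so far only in [B(X)]; the word for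
   [W] uses [P] alone. *)
pose P := Ni *o star T *o M; pose Q := pi Mi *o star W *o pi N.
have [PQ QP QPQ] : [/\ pi P *o Q = W *o pi T, Q *o pi P = pi T *o W &
    Q *o pi P *o Q = Q].
  rewrite !repM repS; apply: weighted_adjoint hW; rewrite -?repS -?repM.
  - by rewrite sM.
  - by rewrite sN.
  - by rewrite MMi.
  - by rewrite MiM.
  - by rewrite NNi.
  - by rewrite NiN.
have [|V [SV VS VW]] := regular_wmp_algebra FWF WFW QPQ PQ QP (K := pi K).
  by rewrite -!repM TKT.
pose S := P *o T + (sone - K *o T).
have piS : pi S = pi P *o pi T + (sone - pi K *o pi T) by rewrite !repE.
rewrite -piS in SV VS.
have [V' _ piV'] := faithful_invertible pi_morph pi_inj pi1 SV VS.
by exists (P *o T *o V' *o V' *o P); rewrite -VW -piV' -!repM.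
Qed.
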